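(* Let $k:\mathbb R^d\times\mathcal H\to\mathbb N$ be a deterministic function specified independently of $\mathcal T^N$, and let $\delta>0$. Then for all $h\in\mathcal H$, with probability $1-\delta$ with respect to the random draw of a training set $\mathcal T^N$ of size $N$, the generalization error of $h$ is upper bounded as $$\Pr_{x,y}[h^Txy\le 0]\le\frac1N\sum_{n=1}^N\min\left(1,2f_{k(x_ny_n,h)}(\theta^h_{x_ny_n})\right)+2\sqrt{\frac2\pi}\sqrt{\frac1N\max_{1\le n\le N}k(x_ny_n,h)}+3\sqrt{\frac{\log(2/\delta)}{2N}}+3\sqrt{\frac{\log 2}{2}}\sqrt{\frac1N\max_{1\le n\le N}k(x_ny_n,h)}.$$
   Context: Setting: $\mathcal X\subseteq\mathbb R^d$, $\mathcal D$ is an unknown distribution on $\mathcal X\times\{-1,1\}$, and $\mathcal T^N=\{(x_n,y_n)\}_{n=1}^N$ is a training set drawn i.i.d. from $\mathcal D$; $\Pr_{x,y}$ is with respect to a fresh $(x,y)\sim\mathcal D$. $\mathcal H=\{x\mapsto\mathrm{sign}(h^Tx):h\in\mathbb R^d\}$ is the class of homogeneous linear classifiers, identified with the set of normals $h\in\mathbb R^d$. $\mathbb N$ denotes the positive integers. For (nonzero) $u,h\in\mathbb R^d$, $\theta_u^h$ is the angle between them. For a positive integer $k$, with $R$ a $k\times d$ matrix of i.i.d. zero-mean Gaussian entries, the flipping probability is $f_k(\theta_u^h):=\Pr_R((Rh)^TRu\le 0)$, which depends only on $k$ and the angle: $f_k(\theta)=\frac{\Gamma(k)}{(\Gamma(k/2))^2}\int_0^{\frac{1-\cos\theta}{1+\cos\theta}}\frac{z^{(k-2)/2}}{(1+z)^k}\,dz$.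 *)

(* Defs.v *)
From HB Require Import structures.
From mathcomp Require Import all_boot all_order all_algebra.
From mathcomp Require Import all_classical all_reals all_analysis.

Set Implicit Arguments.
Unset Strict Implicit.
Unset Printing Implicit Defensive.

Import Order.TTheory GRing.Theory Num.Theory.
Import numFieldNormedType.Exports.

Local Open Scope classical_set_scope.
Local Open Scope ring_scope.

Section iid_law.
Context {d : measure_display} {T : measurableType d} {R : realType}.

Definition tuple_cons (n : nat) (z : T * n.-tuple T) : n.+1.-tuple T :=
  [tuple of z.1 :: z.2].

Lemma measurable_tuple_cons (n : nat) :
  measurable_fun [set: T * n.-tuple T] (@tuple_cons n).
Proof. exact: measurable_cons. Qed.

HB.instance Definition _ (n : nat) :=
  isMeasurableFun.Build _ _ _ _ (@tuple_cons n) (@measurable_tuple_cons n).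

(* The n-fold product measure of mu, i.e. the joint law of n i.i.d. draws from
   mu; [iid_lawE] is its characteristic product rule. *)
Fixpoint iid_law (mu : probability T R) (n : nat) : probability (n.-tuple T) R :=
  match n with
  | 0 => \d_([tuple] : 0.-tuple T)
  | m.+1 => distribution (mu \x iid_law mu m)%E (@tuple_cons m)
  end.

Lemma iid_lawE (mu : probability T R) (n : nat) (A : 'I_n -> set T) :
  (forall i, measurable (A i)) ->
  iid_law mu n [set t | forall i, A i (tnth t i)] = (\prod_(i < n) mu (A i))%E.
Proof.
elim: n A => [|n IHn] A mA /=.
  rewrite big_ord0 diracE mem_set//= => -[]//.
rewrite big_ord_recl /distribution/= /pushforward/=.
rewrite (_ : _ @^-1` _ = A ord0 `*`
    [set t | forall i, A (lift ord0 i) (tnth t i)]); last first.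
  apply/seteqP; split => [[x t] /= H|[x t] /= [Ax At] i].
    by split => [|i]; [have := H ord0|have := H (lift ord0 i); rewrite tnthS].
  by case: (unliftP ord0 i) => [j ->|->]//; rewrite tnthS.
rewrite product_measure1E//; last first.
  rewrite (_ : mkset _ = \bigcap_(i in [set: 'I_n])
      ((fun t => tnth t i) @^-1` A (lift ord0 i))); last first.
    by apply/seteqP; split => [t At i _|t At i]; exact: At.
  apply: fin_bigcap_measurable => // i _; rewrite -[X in measurable X]setTI.
  exact: measurable_tnth.
by congr (_ * _)%E; exact: (IHn (fun i => A (lift ord0 i))).
Qed.

End iid_law.

Section halfspaces.
Context {R : realType}.

Definition dotv (m : nat) (u v : 'cV[R]_m) : R := (u^T *m v) 0 0.

(* A labelled point (x, y) is stored as a pair (t, b): t lists the coordinates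
   of x, and b encodes the label y = 1 (b = true) or y = -1 (b = false). *)
Definition label (b : bool) : R := if b then 1 else -1.

Definition signed_point (d : nat) (z : d.-tuple R * bool) : 'cV[R]_d :=
  label z.2 *: \col_j tnth z.1 j.

Definition gen_error (d : nat) (D : probability (d.-tuple R * bool)%type R)
    (h : 'cV[R]_d) : R :=
  fine (D [set z | dotv h (signed_point z) <= 0]).

(* [normal_prob] lives on [measurableTypeR R], whose sigma-algebra is that of R
   under another display; transporting it along the identity is the same law. *)
Definition borel_id : measurableTypeR R -> R := idfun.

Lemma measurable_borel_id : measurable_fun [set: measurableTypeR R] borel_id.
Proof. exact: measurable_id. Qed.

HB.instance Definition _ :=
  isMeasurableFun.Build _ _ _ _ borel_id measurable_borel_id.

Definition gaussian (sigma : R) : probability R R :=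
  distribution (normal_prob 0 sigma) borel_id.

(* The law of a k x d matrix of i.i.d. N(0, sigma^2) entries, stored as the
   k-tuple of its rows. *)
Definition gaussian_mx_law (sigma : R) (k d : nat) :
    probability (k.-tuple (d.-tuple R)) R :=
  iid_law (iid_law (gaussian sigma) d) k.

Definition mx_of_rows (k d : nat) (G : k.-tuple (d.-tuple R)) : 'M[R]_(k, d) :=
  \matrix_(i, j) tnth (tnth G i) j.

(* f_k(theta_u^h).  It depends on u and h only through their angle when both
   are nonzero, and equals 1 when u = 0 or h = 0. *)
Definition flip_prob (sigma : R) (k d : nat) (u h : 'cV[R]_d) : R :=
  fine (gaussian_mx_law sigma k d
    [set G | dotv (mx_of_rows G *m h) (mx_of_rows G *m u) <= 0]).

End halfspaces.

(* Main.v *)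
Require Import Defs.
From mathcomp Require Import all_boot all_order all_algebra.
From mathcomp Require Import all_classical all_reals all_analysis.
From mathcomp Require Import measurable_realfun.
From mathcomp Require Import ring lra.

Set Implicit Arguments.
Unset Strict Implicit.
Unset Printing Implicit Defensive.

Import Order.TTheory GRing.Theory Num.Theory.
Import numFieldNormedType.Exports.

Local Open Scope classical_set_scope.
Local Open Scope ring_scope.

(** Let c be the cosine of the angle between the normal h and the signed point x y, and
    put L_k = sqrt (1 + 2 k / pi). The proof inserts a clipped linear function between
    the zero-one loss and the loss of the theorem:

      1[c <= 0]  <=  ramp_k(c) := max(0, min(1, 1 - L_k c))  <=  min(1, 2 f_k).

    The first inequality is clear. The second one ([ramp_le_flip]) comes from
    [flip_prob_ge]: by rotation invariance of the Gaussian, the projected scalar product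
    of h and x y is, conditionally on the projection X of h, a Gaussian variable whose
    mean and deviation have ratio |X| cot(theta) ([gaussian_joint],
    [gaussian_row_products]); its density is bounded and the mean length of X is at most
    sqrt k, so 2 f_k >= 1 - sqrt (2 k / pi) cot(theta), which is at least 1 - L_k c where
    the latter is positive.

    The dimension k may depend on the sample point. But ramp_k(c) decreases in k, so the
    empirical ramp loss for the largest dimension that occurs in the sample is at most
    the empirical loss of the theorem. It therefore suffices to prove, for each fixed k, a
    bound that is uniform in h, and to take a union bound over k with weights 2 ^- k.
    Only k <= N matters, since for larger k the right-hand side exceeds 1.

    For fixed k the ramp losses are L_k-Lipschitz functions of the scalar product of two
    unit vectors. Their largest deviation from the mean, over a finite net of directions
    ([ball_net]), has expectation at most 2 L_k / sqrt N by symmetrization and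
    contraction ([expected_sample_max]) and concentrates by bounded differences
    ([expR_sample_max_le]); both facts are proved by induction on the sample size, one
    point at a time ([uniform_ramp_bound]). The concentration term of dimension k is at
    most 2 sqrt (log(2/delta) / (2 N)) + 2 sqrt (log 2 / 2) sqrt ((k - 1) / N). Since
    L_k is close to sqrt (2 / pi) sqrt k, all constants fit within those of the theorem
    ([slope_budget]); the factor 3 in place of 2 leaves room for the net and for the
    difference between L_k and sqrt (2 k / pi). *)

(** * Expectations of bounded measurable functions *)

Section bounded_expectation.
Context {R : realType}.

(** Bounded measurable functions are integrable for every probability, and are
    stable under all the operations used below, so that real-valued expectations of
    them obey linearity, monotonicity and Fubini without side conditions. *)
Definition bounded_measurable d (T : measurableType d) (f : T -> R) :=
  measurable_fun [set: T] f /\ exists M, forall x, `|f x| <= M.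

Section one_space.
Context d (T : measurableType d).
Implicit Types (f g : T -> R) (P : probability T R).

Lemma bmf_cst c : bounded_measurable (fun _ : T => c).
Proof. by split; [exact: measurable_cst|exists `|c|]. Qed.

Lemma bmfD f g : bounded_measurable f -> bounded_measurable g ->
  bounded_measurable (fun x => f x + g x).
Proof.
move=> [mf [M fM]] [mg [M' gM]]; split; first exact: measurable_funD.
by exists (M + M') => x; rewrite (le_trans (ler_normD _ _))// lerD.
Qed.

Lemma bmfZ c f : bounded_measurable f -> bounded_measurable (fun x => c * f x).
Proof.
move=> [mf [M fM]]; split; first exact: measurable_funM.
by exists (`|c| * M) => x; rewrite normrM ler_wpM2l.
Qed.

Lemma bmfB f g : bounded_measurable f -> bounded_measurable g ->
  bounded_measurable (fun x => f x - g x).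
Proof.
move=> bf bg; have := bmfD bf (bmfZ (-1) bg).
by under eq_fun do rewrite mulN1r.
Qed.

Lemma bmf_expR f : bounded_measurable f ->
  bounded_measurable (fun x => expR (f x)).
Proof.
move=> [mf [M fM]]; split; first exact: measurableT_comp.
exists (expR M) => x; rewrite ger0_norm ?expR_ge0// ler_expR.
exact: le_trans (ler_norm _) _.
Qed.

Lemma bmf_maxr f g : bounded_measurable f -> bounded_measurable g ->
  bounded_measurable (fun x => Num.max (f x) (g x)).
Proof.
move=> [mf [M fM]] [mg [M' gM]].
split; first exact: measurable_maxr.
exists (Num.max M M') => x; rewrite maxEle le_max.
by case: ifPn => _; rewrite ?fM ?gM ?orbT.
Qed.

Lemma bmf_sum (I : Type) (r : seq I) (F : I -> T -> R) :
  (forall i, bounded_measurable (F i)) ->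
  bounded_measurable (fun x => \sum_(i <- r) F i x).
Proof.
move=> bF; elim: r => [|i r IH].
  by under eq_fun do rewrite big_nil; exact: bmf_cst.
by under eq_fun do rewrite big_cons; exact: bmfD.
Qed.

Lemma bmf_bigmax (I : Type) (r : seq I) (F : I -> T -> R) g :
  bounded_measurable g -> (forall i, bounded_measurable (F i)) ->
  bounded_measurable (fun x => \big[Num.max/g x]_(i <- r) F i x).
Proof.
move=> bg bF; elim: r => [|i r IH].
  by under eq_fun do rewrite big_nil.
by under eq_fun do rewrite big_cons; exact: bmf_maxr.
Qed.

Lemma bmf_comp d' (T' : measurableType d') (h : T' -> T) f :
  measurable_fun [set: T'] h -> bounded_measurable f ->
  bounded_measurable (fun x => f (h x)).
Proof.
move=> mh [mf [M fM]]; split; first exact: measurableT_comp.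
by exists M.
Qed.

Lemma bmf_integrable P f : bounded_measurable f ->
  P.-integrable [set: T] (EFin \o f).
Proof.
move=> [mf [M fM]]; apply: measurable_bounded_integrable => //.
  by rewrite (le_lt_trans (probability_le1 _ _))// ltry.
exists M; split; first by rewrite num_real.
by move=> M' MM' x _ /=; rewrite (le_trans (fM x))// ltW.
Qed.

Lemma bmf_RintD P f g : bounded_measurable f -> bounded_measurable g ->
  \int[P]_x (f x + g x) = \int[P]_x f x + \int[P]_x g x.
Proof. by move=> bf bg; rewrite RintegralD//; exact: bmf_integrable. Qed.

Lemma bmf_RintB P f g : bounded_measurable f -> bounded_measurable g ->
  \int[P]_x (f x - g x) = \int[P]_x f x - \int[P]_x g x.
Proof. by move=> bf bg; rewrite RintegralB//; exact: bmf_integrable. Qed.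

Lemma bmf_RintZ P c f : bounded_measurable f ->
  \int[P]_x (c * f x) = c * \int[P]_x f x.
Proof. by move=> bf; rewrite RintegralZl//; exact: bmf_integrable. Qed.

Lemma Rint_cst P c : \int[P]_x (cst c x) = c.
Proof.
rewrite Rintegral_cst// -[RHS]mulr1; congr (_ * _).
exact: (congr1 fine (probability_setT P)).
Qed.

Lemma bmf_RintDc P f c : bounded_measurable f ->
  \int[P]_x (f x + c) = \int[P]_x f x + c.
Proof. by move=> bf; rewrite (bmf_RintD P bf (bmf_cst c)) Rint_cst. Qed.

Lemma bmf_le_Rint P f g : bounded_measurable f -> bounded_measurable g ->
  (forall x, f x <= g x) -> \int[P]_x f x <= \int[P]_x g x.
Proof. by move=> bf bg fg; rewrite le_Rintegral//; exact: bmf_integrable. Qed.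

Lemma bmf_Rint_le P f c : bounded_measurable f ->
  (forall x, f x <= c) -> \int[P]_x f x <= c.
Proof.
by move=> bf fc; rewrite -[leRHS](Rint_cst P c) bmf_le_Rint//; exact: bmf_cst.
Qed.

Lemma bmf_Rint_ge P f c : bounded_measurable f ->
  (forall x, c <= f x) -> c <= \int[P]_x f x.
Proof.
by move=> bf fc; rewrite -[leLHS](Rint_cst P c) bmf_le_Rint//; exact: bmf_cst.
Qed.

Lemma bmf_RintE P f : bounded_measurable f ->
  ((\int[P]_x f x)%:E = \int[P]_x (f x)%:E)%E.
Proof.
by move=> bf; rewrite /Rintegral fineK//; exact/integrable_fin_num/bmf_integrable.
Qed.

End one_space.

Section two_spaces.
Context d1 d2 (T1 : measurableType d1) (T2 : measurableType d2).
Variables (P1 : probability T1 R) (P2 : probability T2 R).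

Lemma bmf_pairl (f : T1 * T2 -> R) x : bounded_measurable f ->
  bounded_measurable (fun y => f (x, y)).
Proof. exact: (bmf_comp (h := pair x)). Qed.

Lemma bmf_pairr (f : T1 * T2 -> R) y : bounded_measurable f ->
  bounded_measurable (fun x => f (x, y)).
Proof. exact: (bmf_comp (h := fun x => (x, y))). Qed.

Lemma bmf_Rint1 (f : T1 * T2 -> R) : bounded_measurable f ->
  bounded_measurable (fun x => \int[P2]_y f (x, y)).
Proof.
move=> bf; split.
  apply/measurable_EFinP.
  have := measurable_fubini_F (bmf_integrable (P1 \x P2)%E bf).
  rewrite /fubini_F/=; apply: eq_measurable_fun => x _ /=.
  by rewrite -bmf_RintE//; exact: bmf_pairl.
case: (bf) => mf [M fM]; exists M => x.
have bfx : bounded_measurable (fun y => f (x, y)) by exact: bmf_pairl.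
rewrite ler_norml bmf_Rint_ge/=//; last first.
  by move=> y; have := fM (x, y); rewrite ler_norml => /andP[].
by apply: bmf_Rint_le => // y; rewrite (le_trans (ler_norm _)).
Qed.

Lemma bmf_Fubini (f : T1 * T2 -> R) : bounded_measurable f ->
  \int[P1]_x \int[P2]_y f (x, y) = \int[P2]_y \int[P1]_x f (x, y).
Proof.
move=> bf; rewrite /Rintegral; congr fine.
transitivity (\int[P1]_x \int[P2]_y (f (x, y))%:E)%E.
  by apply: eq_integral => x _; rewrite -bmf_RintE//; exact: bmf_pairl.
rewrite (@Fubini _ _ _ _ _ P1 P2 (EFin \o f))//; last exact: bmf_integrable.
by apply: eq_integral => y _; rewrite -bmf_RintE//; exact: bmf_pairr.
Qed.

Lemma bmf_Rint_prod (f : T1 * T2 -> R) : bounded_measurable f ->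
  \int[(P1 \x P2)%E]_z f z = \int[P1]_x \int[P2]_y f (x, y).
Proof.
move=> bf; rewrite /Rintegral; congr fine.
rewrite -(@integral12_prod_meas1 _ _ _ _ _ P1 P2 (EFin \o f))//;
  last exact: bmf_integrable.
by apply: eq_integral => x _; rewrite [RHS]bmf_RintE//; exact: bmf_pairl.
Qed.
End two_spaces.

Lemma bmf_Rint_tuple d (T : measurableType d) (P : probability T R) n
  (f : n.+1.-tuple T -> R) : bounded_measurable f ->
  \int[iid_law P n.+1]_S f S =
  \int[P]_z \int[iid_law P n]_S f (tuple_cons (z, S)).
Proof.
move=> bf; rewrite -(@bmf_Rint_prod _ _ _ _ _ _ (fun zS => f (tuple_cons zS))).
  rewrite /Rintegral; congr fine.
  rewrite /= integral_pushforward//=.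
    by case: bf => mf _; exact/measurable_EFinP.
  have btc : bounded_measurable (f \o @tuple_cons _ T n).
    by apply: (bmf_comp _ bf); exact: measurable_tuple_cons.
  exact: (bmf_integrable (P \x iid_law P n)%E btc).
by apply: (bmf_comp _ bf); exact: measurable_tuple_cons.
Qed.

Lemma Rint_tuple0 d (T : measurableType d) (P : probability T R)
  (f : 0.-tuple T -> R) : bounded_measurable f -> \int[iid_law P 0]_S f S = f [tuple].
Proof.
move=> [mf _]; rewrite /Rintegral/= integral_dirac//.
  by rewrite diracT mul1e.
exact/measurable_EFinP.
Qed.

End bounded_expectation.

(** * Exponential moments *)

Section exponential_moments.
Context {R : realType}.

(** Compares the even terms of the exponential series at [x] with the terms at
    [x ^+ 2 / 2]. *)
Lemma factorial_double_ge n : (2 ^ n * n`! <= n.*2`!)%N.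
Proof.
elim: n => // n IH; rewrite doubleS !factS expnS.
rewrite [X in (X <= _)%N](_ : _ = (n.+1 * 2 * (2 ^ n * n`!))%N); last by ring.
by apply: leq_mul; rewrite ?muln2 ?doubleS// (leq_trans IH)// leq_pmull.
Qed.

(** The bound cosh x <= exp (x^2 / 2): the odd terms of the two exponential
    series cancel, and the remaining ones are compared term by term. *)
Lemma expRDN_le (x : R) : expR x + expR (- x) <= 2 * expR (x ^+ 2 / 2).
Proof.
have partial n : series (exp_coeff x) n.*2 + series (exp_coeff (- x)) n.*2
    <= 2 * series (exp_coeff (x ^+ 2 / 2)) n.
  have coefE (y : R) m : exp_coeff y m = y ^+ m / m`!%:R by [].
  have ev m : exp_coeff (- x) m.*2 = exp_coeff x m.*2.
    by rewrite !coefE exprNn -signr_odd odd_double mul1r.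
  have od m : exp_coeff (- x) m.*2.+1 = - exp_coeff x m.*2.+1.
    by rewrite !coefE exprNn -signr_odd oddS odd_double mulN1r mulNr.
  elim: n => [|n IH]; first by rewrite /series/= !big_geq// mulr0 addr0.
  rewrite doubleS /series/= !big_nat_recr//= mulrDr.
  move: IH; rewrite /series/= => IH.
  rewrite [leLHS](_ : _ =
    \sum_(0 <= i < n.*2) exp_coeff x i + \sum_(0 <= i < n.*2) exp_coeff (- x) i
    + 2 * (x ^+ n.*2 / n.*2`!%:R)); last first.
    by rewrite ev od -coefE; ring.
  rewrite lerD// ler_pM2l// coefE -muln2 mulnC exprM expr_div_n -mulrA.
  apply: ler_wpM2l; first by rewrite exprn_ge0// sqr_ge0.
  rewrite -[_ ^- _ / _]invfM lef_pV2 ?posrE ?ltr0n ?fact_gt0//.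
  by rewrite -natrX -natrM ler_nat mul2n factorial_double_ge.
have cdbl : (fun n => n.*2) @ \oo --> \oo.
  apply/cvgnyPge => A; near=> n.
  by rewrite -addnn (leq_trans _ (leq_addr _ _))//; near: n; exact: nbhs_infty_ge.
have cE y : series (exp_coeff y) @ \oo --> expR y.
  exact: is_cvg_series_exp_coeff.
have c1 : series (exp_coeff x) n.*2 + series (exp_coeff (- x)) n.*2
    @[n --> \oo] --> expR x + expR (- x).
  by apply: cvgD; apply: (cvg_comp _ _ cdbl); exact: cE.
have c2 : 2 * series (exp_coeff (x ^+ 2 / 2)) n @[n --> \oo] -->
    2 * expR (x ^+ 2 / 2).
  by apply: cvgMr; exact: cE.
by apply: (ler_cvg_to c1 c2); apply: nearW.
Unshelve. all: by end_near. Qed.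

(** The graph of a convex function lies below its chord over [-1, 1]. *)
Lemma expR_chord_le (l u : R) : -1 <= u <= 1 ->
  expR (l * u) <= 2^-1 * ((1 + u) * expR l + (1 - u) * expR (- l)).
Proof.
move=> /andP[u1 u2].
have t01 : 0 <= (1 + u) / 2 <= 1 by lra.
have /andP[t0 t1] := t01.
have := @convex_expR R (Itv01 t0 t1) l (- l).
rewrite !convRE/= /unstable.onem => H; apply: le_trans (le_trans _ H) _.
  by rewrite ler_expR le_eqVlt; apply/orP; left; apply/eqP; field.
by rewrite le_eqVlt; apply/orP; left; apply/eqP; field.
Qed.

(** After centring, [f] takes values in [-1, 1]; integrating the chord bound kills
    its linear term and leaves a hyperbolic cosine. The sharp constant would be
    [l ^+ 2 / 8]; the weaker one is enough for the final bound. *)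
Lemma hoeffding d (T : measurableType d) (P : probability T R) (f : T -> R) l :
  bounded_measurable f -> (forall x y, `|f x - f y| <= 1) ->
  \int[P]_x expR (l * f x) <= expR (l * \int[P]_x f x + l ^+ 2 / 2).
Proof.
move=> bf f1; set m := \int[P]_x f x.
have fm x : -1 <= f x - m <= 1.
  suff [? ?] : f x - 1 <= m /\ m <= f x + 1 by lra.
  split; [apply: bmf_Rint_ge => // y|apply: bmf_Rint_le => // y];
  by have := f1 x y; rewrite ler_norml => /andP[]; lra.
pose C := 2^-1 * (expR l + expR (- l)); pose D := 2^-1 * (expR l - expR (- l)).
have bu : bounded_measurable (fun x => f x - m) by apply: bmfB => //; exact: bmf_cst.
apply: (@le_trans _ _ (\int[P]_x (expR (l * m) * (C + D * (f x - m))))).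
  apply: bmf_le_Rint.
  - by apply/bmf_expR/bmfZ.
  - by apply/bmfZ/bmfD; [exact: bmf_cst|exact: bmfZ].
  move=> x; rewrite -{1}(subrK m (f x)) mulrDr addrC expRD ler_wpM2l ?expR_ge0//.
  by rewrite (le_trans (expR_chord_le l (fm x)))// /C /D; rewrite le_eqVlt; apply/orP; left; apply/eqP; ring.
rewrite bmf_RintZ; last by apply/bmfD; [exact: bmf_cst|exact: bmfZ].
rewrite bmf_RintD; [|exact: bmf_cst|exact: bmfZ].
have -> : \int[P]_x (D * (f x - m)) = 0.
  rewrite (bmf_RintZ P D bu).
  by rewrite bmf_RintDc// subrr mulr0.
rewrite Rint_cst addr0 expRD ler_wpM2l ?expR_ge0//.
by rewrite ler_pdivrMl// expRDN_le.
Qed.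
End exponential_moments.

(** * Maxima of sums over a sample *)

Section finite_max.
Context {R : realType} (I : finType) (i0 : I).
Implicit Types a b : I -> R.

(** Only finite index sets occur, so that a maximum of measurable functions is
    measurable and always attained. The index [i0] serves as default value. *)
Definition fmax a := \big[Num.max/a i0]_i a i.

Lemma fmax_ge a i : a i <= fmax a.
Proof. exact: le_bigmax. Qed.

Lemma fmax_le a c : (forall i, a i <= c) -> fmax a <= c.
Proof. by move=> ac; apply: bigmax_le. Qed.

Lemma fmax_attained a : exists i, fmax a = a i.
Proof.
rewrite /fmax; elim/big_ind: _ => [|x y [i ->] [j ->]|i _]; [by exists i0| |by exists i].
by rewrite maxEle; case: ifP => _; [exists j|exists i].
Qed.

Lemma fmax_dist a b c : (forall i, `|a i - b i| <= c) -> `|fmax a - fmax b| <= c.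
Proof.
move=> abc.
have ab : fmax a <= fmax b + c.
  apply: fmax_le => i; have := abc i; have := fmax_ge b i.
  by rewrite ler_norml => ? /andP[]; lra.
have ba : fmax b <= fmax a + c.
  apply: fmax_le => i; have := abc i; have := fmax_ge a i.
  by rewrite ler_norml => ? /andP[]; lra.
by rewrite ler_norml; apply/andP; split; lra.
Qed.

Lemma bmf_fmax d (T : measurableType d) (F : T -> I -> R) :
  (forall i, bounded_measurable (fun x => F x i)) ->
  bounded_measurable (fun x => fmax (F x)).
Proof. by move=> bF; apply: bmf_bigmax. Qed.

End finite_max.

Section max_of_sums.
Context {R : realType} d (T : measurableType d) (P : probability T R).
Context (I : finType) (i0 : I).

(** Offsets [a] make the family of these maxima closed under conditioning on one
    sample point: the point [z] is absorbed in the offset [a i + psi i z]. All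
    inductions on the sample size rest on this. *)
Definition sample_max (psi : I -> T -> R) (a : I -> R) n (S : n.-tuple T) :=
  fmax i0 (fun i => a i + \sum_(z <- S) psi i z).

Lemma sample_max_cons psi a n z (S : n.-tuple T) :
  sample_max psi a (tuple_cons (z, S)) = sample_max psi (fun i => a i + psi i z) S.
Proof. by congr fmax; apply/funext => i; rewrite /= big_cons addrA. Qed.

Lemma bmf_sum_tuple (f : T -> R) n : bounded_measurable f ->
  bounded_measurable (fun S : n.-tuple T => \sum_(z <- S) f z).
Proof.
move=> bf; under eq_fun do rewrite big_tuple.
apply: bmf_sum => j; apply: (bmf_comp _ bf); exact: measurable_tnth.
Qed.

Lemma bmf_sample_max d' (T' : measurableType d') psi (a : T' -> I -> R) n
    (h : T' -> n.-tuple T) :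
  (forall i, bounded_measurable (psi i)) ->
  (forall i, bounded_measurable (fun x => a x i)) -> measurable_fun setT h ->
  bounded_measurable (fun x => sample_max psi (a x) (h x)).
Proof.
move=> bpsi ba mh; apply: bmf_fmax => i; apply: bmfD => //.
exact: (bmf_comp mh (bmf_sum_tuple n (bpsi i))).
Qed.

Lemma bmf_sample_max1 psi a n : (forall i, bounded_measurable (psi i)) ->
  bounded_measurable (@sample_max psi a n).
Proof.
move=> bpsi; apply: (@bmf_sample_max _ _ _ (fun _ => a) n id) => // i.
exact: bmf_cst.
Qed.

(** The method of bounded differences. Given the first point [z], the conditional
    expectation [G z] of the maximum varies by at most 1, hence Hoeffding's lemma
    applies to it, while the induction hypothesis controls the remaining points. *)
Lemma expR_sample_max_le psi l : (forall i, bounded_measurable (psi i)) ->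
  (forall i x y, `|psi i x - psi i y| <= 1) ->
  forall n a,
  \int[iid_law P n]_S expR (l * sample_max psi a S) <=
  expR (l * \int[iid_law P n]_S sample_max psi a S + n%:R * (l ^+ 2 / 2)).
Proof.
move=> bpsi psi1; elim=> [|n IH] a.
  rewrite !Rint_tuple0 ?mul0r ?addr0//; first exact: bmf_sample_max1.
  by apply/bmf_expR/bmfZ/bmf_sample_max1.
have bj : bounded_measurable (fun zS : T * n.-tuple T =>
    sample_max psi (fun i => a i + psi i zS.1) zS.2).
  apply: bmf_sample_max => // i; apply: bmfD; first exact: bmf_cst.
  by apply: (bmf_comp _ (bpsi i)).
pose G z := \int[iid_law P n]_S sample_max psi (fun i => a i + psi i z) S.
have bG : bounded_measurable G by exact: (bmf_Rint1 P (iid_law P n) bj).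
have G1 x y : `|G x - G y| <= 1.
  rewrite /G -bmf_RintB; [|exact: bmf_sample_max1..].
  have bB : bounded_measurable (fun S => sample_max psi (fun i => a i + psi i x) S -
      @sample_max psi (fun i => a i + psi i y) n S).
    by apply: bmfB; exact: bmf_sample_max1.
  have dist S : `|sample_max psi (fun i => a i + psi i x) S -
      @sample_max psi (fun i => a i + psi i y) n S| <= 1.
    apply: fmax_dist => i; apply: le_trans (psi1 i x y).
    by rewrite le_eqVlt; apply/orP; left; apply/eqP; congr (`|_|); ring.
  rewrite ler_norml; apply/andP; split.
    by apply: bmf_Rint_ge => // S; have := dist S; rewrite ler_norml => /andP[].
  by apply: bmf_Rint_le => // S; have := dist S; rewrite ler_norml => /andP[].
rewrite bmf_Rint_tuple; last by apply/bmf_expR/bmfZ/bmf_sample_max1.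
rewrite bmf_Rint_tuple; last exact/bmf_sample_max1.
rewrite (eq_Rintegral _ (g := fun z => \int[iid_law P n]_S
    expR (l * sample_max psi (fun i => a i + psi i z) S))); last first.
  by move=> z _; apply: eq_Rintegral => S _; rewrite sample_max_cons.
rewrite [X in expR (l * X + _)](eq_Rintegral _ (g := G)); last first.
  by move=> z _; apply: eq_Rintegral => S _; rewrite sample_max_cons.
apply: (@le_trans _ _ (\int[P]_z (expR (n%:R * (l ^+ 2 / 2)) * expR (l * G z)))).
  apply: bmf_le_Rint.
  - exact: (bmf_Rint1 P (iid_law P n) (bmf_expR (bmfZ l bj))).
  - exact/bmfZ/bmf_expR/bmfZ.
  - by move=> z; rewrite -expRD addrC; exact: IH.
rewrite bmf_RintZ; last exact/bmf_expR/bmfZ.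
rewrite -[n.+1%:R]natr1 mulrDl mul1r addrCA expRD ler_wpM2l ?expR_ge0//.
exact: hoeffding.
Qed.

End max_of_sums.

(** * Symmetrization, contraction and the uniform deviation *)

Section dot_product.
Context {R : realType} (m : nat).
Implicit Types u v w : 'cV[R]_m.

Lemma dotvE u v : dotv u v = \sum_i u i 0 * v i 0.
Proof. by rewrite /dotv mxE; apply: eq_bigr => i _; rewrite mxE. Qed.

Lemma dotvC u v : dotv u v = dotv v u.
Proof. by rewrite !dotvE; apply: eq_bigr => i _; rewrite mulrC. Qed.

Lemma dotvDr u v w : dotv u (v + w) = dotv u v + dotv u w.
Proof. by rewrite /dotv mulmxDr mxE. Qed.

Lemma dotvZr u c v : dotv u (c *: v) = c * dotv u v.
Proof. by rewrite /dotv -scalemxAr mxE. Qed.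

Lemma dotvDl u v w : dotv (u + v) w = dotv u w + dotv v w.
Proof. by rewrite dotvC dotvDr !(dotvC w). Qed.

Lemma dotvZl c u v : dotv (c *: u) v = c * dotv u v.
Proof. by rewrite dotvC dotvZr dotvC. Qed.

Lemma dotv0r u : dotv u 0 = 0.
Proof. by rewrite -(scale0r 0) dotvZr mul0r. Qed.

Lemma dotv_ge0 u : 0 <= dotv u u.
Proof. by rewrite dotvE sumr_ge0// => i _; rewrite -expr2 sqr_ge0. Qed.

Lemma dotv_eq0 u : dotv u u = 0 -> u = 0.
Proof.
rewrite dotvE => /eqP; rewrite psumr_eq0; last by move=> i _; rewrite -expr2 sqr_ge0.
move=> /allP H; apply/matrixP => i j; rewrite (ord1 j) mxE.
by have := H i (mem_index_enum i); rewrite -expr2 sqrf_eq0 => /eqP.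
Qed.

Lemma cauchy_schwarz u v : dotv u v ^+ 2 <= dotv u u * dotv v v.
Proof.
have [u0|u0] := eqVneq (dotv u u) 0.
  by rewrite (dotv_eq0 u0) dotvC !dotv0r expr0n mul0r.
have upos : 0 < dotv u u by rewrite lt_neqAle eq_sym u0 dotv_ge0.
have := dotv_ge0 (dotv u u *: v + (- dotv u v) *: u).
rewrite !(dotvDr, dotvDl, dotvZr, dotvZl) (dotvC v u).
set a := dotv u u; set b := dotv u v; set c := dotv v v.
move=> H; have : 0 <= a * (a * c - b ^+ 2) by lra.
by rewrite pmulr_rge0// subr_ge0.
Qed.

Lemma dotv_le_norm u v : dotv u u <= 1 -> dotv u v <= Num.sqrt (dotv v v).
Proof.
move=> u1; rewrite (le_trans (ler_norm _))// -sqrtr_sqr ler_wsqrtr//.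
by rewrite (le_trans (cauchy_schwarz u v))// ler_piMl// dotv_ge0.
Qed.

End dot_product.

Section averaging.
Context {R : realType} d (T : measurableType d) (P : probability T R).

(** The averaging behind symmetrization with a ghost sample [y]: bounding [F] by an
    average over an independent copy and exchanging the two copies turns a bound on
    [M (z, y) + M (y, z)] into a bound on the mean of [F]. *)
Lemma average_two_points (F K : T -> R) (M : T * T -> R) :
  bounded_measurable F -> bounded_measurable K -> bounded_measurable M ->
  (forall z, F z <= \int[P]_y M (z, y)) ->
  (forall z y, M (z, y) + M (y, z) <= 2^-1 * (K z + K y)) ->
  2 * \int[P]_z F z <= \int[P]_z K z.
Proof.
move=> bF bK bM FM MK.
have bM' : bounded_measurable (fun zz => M (zz.2, zz.1)).
  by apply: (bmf_comp _ bM); exact: measurable_fun_pair measurable_snd measurable_fst.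
pose kap := \int[P]_z K z.
have bM1 := bmf_Rint1 P P bM; have bM2 := bmf_Rint1 P P bM'.
have bI z : bounded_measurable (fun y => M (z, y)) := bmf_pairl z bM.
have bI' z : bounded_measurable (fun y => M (y, z)) := bmf_pairr z bM.
have bKc c : bounded_measurable (fun y => K y + c) := bmfD bK (bmf_cst T c).
have FI : \int[P]_z F z <= \int[P]_z \int[P]_y M (z, y).
  exact: (bmf_le_Rint P bF bM1 FM).
have swap : \int[P]_z \int[P]_y M (z, y) = \int[P]_z \int[P]_y M (y, z).
  exact: (bmf_Fubini P P bM).
have KE c : \int[P]_y (2^-1 * (K y + c)) = 2^-1 * (kap + c).
  by rewrite (bmf_RintZ P 2^-1 (bKc c)) (bmf_RintDc P c bK).
have step z : \int[P]_y M (z, y) + \int[P]_y M (y, z) <= 2^-1 * (K z + kap).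
  rewrite -(bmf_RintD P (bI z) (bI' z)) [K z + _]addrC -KE.
  apply: (bmf_le_Rint P (bmfD (bI z) (bI' z)) (bmfZ 2^-1 (bKc (K z)))) => y.
  by rewrite [K y + _]addrC; exact: MK.
have : \int[P]_z \int[P]_y M (z, y) + \int[P]_z \int[P]_y M (y, z) <=
    2^-1 * (kap + kap).
  rewrite -(bmf_RintD P bM1 bM2) -KE.
  exact: (bmf_le_Rint P (bmfD bM1 bM2) (bmfZ 2^-1 (bKc kap)) step).
rewrite -swap -/kap; move: FI; set X := \int[P]_z F z; set Y := \int[P]_z _.
by move: X Y kap KE step => X Y kap _ _; lra.
Qed.
End averaging.

Section symmetrization.
Context {R : realType} d (T : measurableType d) (P : probability T R).
Context (I : finType) (i0 : I).
Variables (g p : I -> T -> R) (L : R).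
Hypothesis bg : forall i, bounded_measurable (g i).
Hypothesis bp : forall i, bounded_measurable (p i).
Hypothesis gp : forall i j z, `|g i z - g j z| <= L * `|p i z - p j z|.

(** Symmetrization and contraction in one coordinate. The mean of [g i] is replaced by
    its value at an independent copy of [z]; the two maxima so obtained are attained
    at indices [i] and [j], and only the differences [g i - g j] survive, to which
    the Lipschitz bound applies. Averaging the offsets [2 * L * p] and
    [- 2 * L * p] plays the role of a random sign. *)
Lemma symmetrization (a : I -> R) :
  2 * \int[P]_z fmax i0 (fun i => a i + (\int[P]_y g i y - g i z)) <=
  \int[P]_z (fmax i0 (fun i => a i + 2 * L * p i z) +
             fmax i0 (fun i => a i - 2 * L * p i z)).
Proof.
pose F z := fmax i0 (fun i => a i + (\int[P]_y g i y - g i z)).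
pose M (zz : T * T) := fmax i0 (fun i => a i + (g i zz.2 - g i zz.1)).
pose K z := fmax i0 (fun i => a i + 2 * L * p i z) +
             fmax i0 (fun i => a i - 2 * L * p i z).
have bF : bounded_measurable F.
  by apply: bmf_fmax => i; apply: bmfD; [exact: bmf_cst|apply: bmfB => //; exact: bmf_cst].
have bK : bounded_measurable K.
  apply: bmfD; apply: bmf_fmax => i; [apply: bmfD|apply: bmfB];
    by [exact: bmf_cst|exact: bmfZ].
have bM : bounded_measurable M.
  apply: bmf_fmax => i; apply: bmfD; first exact: bmf_cst.
  by apply: bmfB; apply: (bmf_comp _ (bg i)).
have FM z : F z <= \int[P]_y M (z, y).
  apply: fmax_le => i.
  have -> : a i + (\int[P]_y g i y - g i z) = \int[P]_y (g i y + (a i - g i z)).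
    by rewrite bmf_RintDc//; ring.
  apply: bmf_le_Rint; [by apply: bmfD => //; exact: bmf_cst|exact: bmf_pairl|].
  move=> y; rewrite [leLHS](_ : _ = a i + (g i y - g i z)); last by ring.
  exact: (fmax_ge i0 (fun i => a i + (g i y - g i z))).
(* With maximisers i and j, both terms are controlled by a i + a j plus the increments
   of g i - g j at z and y. *)
have MK z y : M (z, y) + M (y, z) <= 2^-1 * (K z + K y).
  rewrite /M/=.
  have [i ->] := fmax_attained i0 (fun i => a i + (g i y - g i z)).
  have [j ->] := fmax_attained i0 (fun i => a i + (g i z - g i y)).
  have Kij x : a i + a j + 2 * (L * `|p i x - p j x|) <= K x.
    have up k : a k + 2 * L * p k x <= fmax i0 (fun i => a i + 2 * L * p i x).
      exact: (fmax_ge i0 (fun i => a i + 2 * L * p i x)).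
    have dn k : a k - 2 * L * p k x <= fmax i0 (fun i => a i - 2 * L * p i x).
      exact: (fmax_ge i0 (fun i => a i - 2 * L * p i x)).
    rewrite /K; have := up i; have := up j; have := dn i; have := dn j.
    by case: ger0P => _; lra.
  have := Kij z; have := Kij y; have := gp i j z; have := gp i j y.
  have := ler_norm (g i y - g j y); have := ler_norm (- (g i z - g j z)).
  by rewrite normrN; lra.
exact: (average_two_points bF bK bM FM MK).
Qed.

End symmetrization.

Section uniform_deviation.
Context {R : realType} d (T : measurableType d) (P : probability T R).
Context (I : finType) (i0 : I) (m : nat).
Variables (g : I -> T -> R) (w : I -> 'cV[R]_m) (e : T -> 'cV[R]_m) (L : R).
Hypothesis bg : forall i, bounded_measurable (g i).
Hypothesis be : forall i, bounded_measurable (fun z => dotv (w i) (e z)).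
Hypothesis L0 : 0 <= L.
Hypothesis w1 : forall i, dotv (w i) (w i) <= 1.
Hypothesis e1 : forall z, dotv (e z) (e z) <= 1.
Hypothesis gL : forall i j z,
  `|g i z - g j z| <= L * `|dotv (w i) (e z) - dotv (w j) (e z)|.

Let psi i z := \int[P]_y g i y - g i z.

Let bpsi i : bounded_measurable (psi i).
Proof. by apply: bmfB => //; exact: bmf_cst. Qed.

(** Each symmetrization step trades one centred term for a random step [2 * L * e z] or
    [- 2 * L * e z] of the vector [v]. By the parallelogram law the mean square length
    of [v] grows by at most [4 * L ^+ 2], and the concavity of the square root passes
    this on to the length itself, which bounds the final maximum by Cauchy-Schwarz. *)
Lemma expected_sample_max n v :
  \int[iid_law P n]_S sample_max i0 psi (fun i => dotv (w i) v) S <=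
  Num.sqrt (dotv v v + 4 * L ^+ 2 * n%:R).
Proof.
elim: n v => [|n IH] v.
  rewrite Rint_tuple0; last exact: bmf_sample_max1.
  rewrite mulr0 addr0; apply: fmax_le => i.
  by rewrite big_nil addr0 dotv_le_norm.
pose A S i := dotv (w i) v + \sum_(z <- S) psi i z.
pose J s (zS : T * n.-tuple T) :=
  sample_max i0 psi (fun i => dotv (w i) (v + (s * (2 * L)) *: e zS.1)) zS.2.
pose H (zS : T * n.-tuple T) :=
  sample_max i0 psi (fun i => dotv (w i) v + psi i zS.1) zS.2.
have bH : bounded_measurable H.
  apply: bmf_sample_max => // i; apply: bmfD; first exact: bmf_cst.
  exact: (bmf_comp _ (bpsi i)).
have bJ s : bounded_measurable (J s).
  apply: bmf_sample_max => // i; under eq_fun do rewrite dotvDr dotvZr.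
  apply: bmfD; first exact: bmf_cst.
  by apply: bmfZ; apply: (bmf_comp _ (be i)).
rewrite bmf_Rint_tuple; last exact: bmf_sample_max1.
rewrite (eq_Rintegral _ (g := fun z => \int[iid_law P n]_S H (z, S))); last first.
  by move=> z _; apply: eq_Rintegral => S _; rewrite sample_max_cons.
rewrite bmf_Fubini//.
have step S : \int[P]_z H (z, S) <=
    2^-1 * \int[P]_z (J 1 (z, S) + J (-1) (z, S)).
  have := symmetrization P i0 bg be gL (A S).
  rewrite mulrC -ler_pdivlMr// mulrC => HS.
  rewrite (eq_Rintegral _ (g := fun z => fmax i0 (fun i => A S i + psi i z)));
    last by move=> z _; congr fmax; apply/funext => i; rewrite /A/= addrAC.
  apply: le_trans HS _; rewrite le_eqVlt; apply/orP; left; apply/eqP; congr (_ * _).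
  apply: eq_Rintegral => z _; rewrite /J /sample_max/=.
  by congr (_ + _); congr fmax; apply/funext => i; rewrite dotvDr dotvZr /A; ring.
pose B zS := J 1 zS + J (-1) zS.
have bB : bounded_measurable B by exact: bmfD.
apply: (@le_trans _ _ (\int[iid_law P n]_S (2^-1 * \int[P]_z B (z, S)))).
  have bB' : bounded_measurable (fun Sz => B (Sz.2, Sz.1)).
    by apply: (bmf_comp _ bB); exact: measurable_fun_pair measurable_snd measurable_fst.
  have bH' : bounded_measurable (fun Sz => H (Sz.2, Sz.1)).
    by apply: (bmf_comp _ bH); exact: measurable_fun_pair measurable_snd measurable_fst.
  apply: bmf_le_Rint => //.
    exact: (bmf_Rint1 (iid_law P n) P bH').
  by apply: bmfZ; exact: (bmf_Rint1 (iid_law P n) P bB').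
rewrite bmf_RintZ; last first.
  have bB' : bounded_measurable (fun Sz => B (Sz.2, Sz.1)).
    by apply: (bmf_comp _ bB); exact: measurable_fun_pair measurable_snd measurable_fst.
  exact: (bmf_Rint1 (iid_law P n) P bB').
rewrite -bmf_Fubini//.
rewrite ler_pdivrMl//; apply: bmf_Rint_le.
  exact: (bmf_Rint1 P (iid_law P n) bB).
move=> z; rewrite /B bmf_RintD; [|exact: bmf_pairl..].
rewrite /J/=; apply: le_trans (lerD (IH _) (IH _)) _.
set x := e z; set c := 4 * L ^+ 2 * n%:R.
have c0 : 0 <= c by rewrite !mulr_ge0// sqr_ge0.
set X := dotv _ _ + c; set Y := dotv _ _ + c.
set Z := dotv v v + 4 * L ^+ 2 * n.+1%:R.
have X0 : 0 <= X by rewrite addr_ge0// dotv_ge0.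
have Y0 : 0 <= Y by rewrite addr_ge0// dotv_ge0.
(* parallelogram law *)
have XYZ : X + Y <= 2 * Z.
  rewrite /X /Y /Z -natr1 !(dotvDr, dotvDl, dotvZr, dotvZl) (dotvC x v).
  have xx : L ^+ 2 * dotv x x <= L ^+ 2 by rewrite ler_piMr ?sqr_ge0// e1.
  rewrite /c; nra.
have Z0 : 0 <= Z by lra.
rewrite -(@ler_pXn2r _ 2) ?nnegrE ?addr_ge0 ?mulr_ge0 ?sqrtr_ge0//.
have := sqr_ge0 (Num.sqrt X - Num.sqrt Y).
have := sqr_sqrtr X0; have := sqr_sqrtr Y0; have := sqr_sqrtr Z0.
nra.
Qed.

(** Markov's inequality for the exponential, optimised at [l = s / n]. *)
Lemma sample_max_tail n (s : R) : (0 < n)%N -> 0 <= s ->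
  (forall i x y, `|g i x - g i y| <= 1) ->
  (iid_law P n [set S | (2 * L * Num.sqrt n%:R + s < sample_max i0 psi (fun=> 0) S)%R]
   <= (expR (- (s ^+ 2 / (2 * n%:R)))%R)%:E)%E.
Proof.
move=> n0 s0 g1.
have n0' : 0 < n%:R :> R by rewrite ltr0n.
have n0'' : n%:R != 0 :> R by rewrite gt_eqF.
set F := @sample_max _ _ _ _ i0 psi (fun=> 0) n.
have bF : bounded_measurable F by exact: bmf_sample_max1.
set tau := 2 * L * Num.sqrt n%:R + s; set A := [set S | _].
have mA : measurable A.
  have := measurable_fun_ltr (measurable_cst tau) bF.1.
  by move=> /(_ measurableT [set true]); rewrite setTI; exact.
pose l := s / n%:R.
have l0 : 0 <= l by rewrite divr_ge0.
have bA : bounded_measurable (\1_A : n.-tuple T -> R).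
  split; first exact: measurable_indic.
  by exists 1 => S; rewrite indicE; case: (_ \in _); rewrite ?normr1 ?normr0.
have PA : iid_law P n A = (\int[iid_law P n]_S \1_A S)%:E.
  by rewrite bmf_RintE// integral_indic// setIT.
rewrite PA lee_fin.
have EF : \int[iid_law P n]_S F S <= 2 * L * Num.sqrt n%:R.
  have := expected_sample_max n 0; rewrite dotv0r add0r.
  rewrite (eq_Rintegral _ (g := F)); last first.
    by move=> S _; congr fmax; apply/funext => i; rewrite dotv0r.
  rewrite sqrtrM ?mulr_ge0 ?sqr_ge0// (_ : 4 * L ^+ 2 = (2 * L) ^+ 2); last by ring.
  by rewrite sqrtr_sqr ger0_norm ?mulr_ge0.
apply: (@le_trans _ _ (\int[iid_law P n]_S (expR (- (l * tau)) * expR (l * F S)))).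
  apply: bmf_le_Rint => //; first by apply/bmfZ/bmf_expR/bmfZ.
  move=> S; rewrite -expRD indicE; case: (boolP (S \in A)) => [|_]; last exact: expR_ge0.
  rewrite inE => AS; rewrite -[leLHS]expR0 ler_expR.
  by rewrite addrC subr_ge0 ler_wpM2l// ltW.
rewrite bmf_RintZ; last exact/bmf_expR/bmfZ.
have psi1 i x y : `|psi i x - psi i y| <= 1.
  apply: le_trans (g1 i y x); rewrite le_eqVlt; apply/orP; left.
  by apply/eqP; congr (`|_|); rewrite /psi; ring.
have := @expR_sample_max_le _ _ _ P _ i0 psi l bpsi psi1 n (fun=> 0).
rewrite -/F => H; apply: (@le_trans _ _ (expR (- (l * tau)) *
    expR (l * \int[iid_law P n]_S F S + n%:R * (l ^+ 2 / 2)))).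
  by rewrite ler_wpM2l ?expR_ge0.
rewrite -expRD ler_expR.
have lE := ler_wpM2l l0 EF.
have -> : s ^+ 2 / (2 * n%:R) = l * s - n%:R * (l ^+ 2 / 2) by rewrite /l; field.
by rewrite /tau mulrDr; lra.
Qed.

End uniform_deviation.

(** * Rotation invariance of the Gaussian law *)

Section lebesgue_affine.
Local Open Scope ereal_scope.
Context {R : realType}.
Notation mu := (@lebesgue_measure R).
Variables (b c : R).
Hypothesis b0 : b != 0%R.

Definition affine (x : measurableTypeR R) : measurableTypeR R := (b * x + c)%R.

Lemma measurable_affine : measurable_fun [set: measurableTypeR R] affine.
Proof. by apply: measurable_funD => //; apply: measurable_funM. Qed.

(** The image of Lebesgue measure under [affine], rescaled so that it should again be
    Lebesgue measure. *)
Definition affine_image : {measure set (measurableTypeR R) -> \bar R} :=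
  mscale (NngNum (normr_ge0 b))
    (measure_function_pushforward__canonical__measure_function_Measure
       mu measurable_affine).

Lemma lebesgue_measure_affine (A : set R) : measurable A ->
  mu A = `|b|%:E * mu (affine @^-1` A).
Proof.
move=> mA.
suff H : mu A = affine_image A by rewrite H.
(* Half-open intervals determine a Borel measure. *)
apply: lebesgue_measure_unique => // _ [[p q]] _ <-.
rewrite /affine_image/= /mscale/= /pushforward.
have [bp|bn|/eqP] := ltgtP 0%R b; last by rewrite eq_sym (negbTE b0).
- rewrite (_ : affine @^-1` _ = `](p - c) / b, (q - c) / b]%classic)%R; last first.
    apply/seteqP; split => x /=; rewrite !in_itv/= /affine;
      by rewrite ltr_pdivrMr// ler_pdivlMr// (mulrC x) ltrBlDr lerBrDr.
  rewrite !lebesgue_measure_itv/= !lte_fin ltr_pM2r ?invr_gt0// ltrD2r.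
  case: ifPn => _; last by rewrite mule0.
  by rewrite gtr0_norm// -!EFinB -EFinM; congr EFin; field.
- rewrite (_ : affine @^-1` _ = `[(q - c) / b, (p - c) / b[%classic)%R; last first.
    apply/seteqP; split => x /=; rewrite !in_itv/= /affine;
      by rewrite ler_ndivrMr// ltr_ndivlMr// (mulrC x) ltrBlDr lerBrDr andbC.
  rewrite !lebesgue_measure_itv/= !lte_fin ltr_nM2r ?invr_lt0// ltrD2r.
  case: ifPn => _; last by rewrite mule0.
  by rewrite ltr0_norm// -!EFinB -EFinM; congr EFin; field.
Qed.

Lemma ge0_integral_affine (f : R -> \bar R) :
  measurable_fun [set: measurableTypeR R] f -> (forall x, 0 <= f x) ->
  \int[mu]_x f x = `|b|%:E * \int[mu]_x f (b * x + c)%R.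
Proof.
move=> mf f0.
rewrite (eq_measure_integral affine_image); last first.
  by move=> A mA _; exact: lebesgue_measure_affine.
rewrite ge0_integral_mscale//= ge0_integral_pushforward//=.
exact: measurable_affine.
Qed.

End lebesgue_affine.

Section gaussian.
Local Open Scope ereal_scope.
Context {R : realType} (sigma : R).
Hypothesis sigma0 : sigma != 0%R.
Notation mu := (@lebesgue_measure R).
Notation phi := (normal_pdf 0 sigma).

(** The density of the normal law is its Radon-Nikodym derivative, up to a null set. *)
Lemma ge0_integral_normal_prob (f : R -> \bar R) :
  measurable_fun [set: measurableTypeR R] f -> (forall x, 0 <= f x) ->
  \int[normal_prob 0 sigma]_x f x = \int[mu]_x (f x * (phi x)%:E).
Proof.
move=> mf f0.
have dom := @normal_prob_dominates R 0 sigma.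
rewrite -(Radon_Nikodym_SigmaFinite.change_of_variables dom)//=.
have If : mu.-integrable [set: measurableTypeR R]
    (Radon_Nikodym_SigmaFinite.f (normal_prob 0 sigma) mu).
  exact: Radon_Nikodym_SigmaFinite.f_integrable.
apply: ae_eq_integral => //.
- by apply: emeasurable_funM => //; exact: measurable_int If.
- apply: emeasurable_funM => //; apply/measurable_EFinP.
  exact: measurable_normal_pdf.
- apply: ae_eqe_mul2l; apply: integral_ae_eq => //.
    by apply/measurable_EFinP; exact: measurable_normal_pdf.
  move=> E _ mE; rewrite -Radon_Nikodym_SigmaFinite.f_integral//.
Qed.

End gaussian.

Section lebesgue_rotation.
Local Open Scope ereal_scope.
Context {R : realType}.
Notation mu := (@lebesgue_measure R).
Notation RR := (measurableTypeR R * measurableTypeR R)%type.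

(** A rotation is obtained from one affine substitution in each variable:
    [y = (u - a * x) / b] with [x] fixed, then [x = a * u - b * v] with [u] fixed.
    The Jacobians [1 / b] and [b] cancel. *)
Lemma lebesgue_rotation (a b : R) (H : RR -> \bar R) :
  measurable_fun [set: RR] H -> (forall z, 0 <= H z) ->
  (a ^+ 2 + b ^+ 2 = 1)%R -> b != 0%R ->
  \int[mu]_x \int[mu]_y H (x, y) =
  \int[mu]_x \int[mu]_y H (a * x - b * y, b * x + a * y)%R.
Proof.
move=> mH H0 ab b0.
have bV0 : (b^-1 != 0)%R by rewrite invr_eq0.
have Nb0 : (- b != 0)%R by rewrite oppr_eq0.
pose H1 (z : RR) := H (z.1, b^-1 * z.2 + (- (a / b) * z.1))%R.
have mH1 : measurable_fun [set: RR] H1.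
  apply: (measurableT_comp mH); apply: measurable_fun_pair => //.
  by apply: measurable_funD; apply: measurable_funM.
transitivity (\int[mu]_x ((`|b^-1|%R)%:E * \int[mu]_y H1 (x, y))).
  apply: eq_integral => x _.
  rewrite (ge0_integral_affine (- (a / b) * x)%R bV0)//.
  exact: measurableT_comp.
rewrite ge0_integralZl//=; last 2 first.
- exact: (measurable_fun_fubini_tonelli_F H1 mH1 (fun _ => H0 _)).
- by move=> x _; apply: integral_ge0 => y _; exact: H0.
rewrite (fubini_tonelli H1 mH1 (fun _ => H0 _)).
rewrite -ge0_integralZl//=; last 2 first.
- exact: (measurable_fun_fubini_tonelli_G H1 mH1 (fun _ => H0 _)).
- by move=> x _; apply: integral_ge0 => y _; exact: H0.
apply: eq_integral => u _.
rewrite (ge0_integral_affine (a * u)%R Nb0); [|exact: (measurableT_comp mH1 (pair2_measurable u))|by move=> x; exact: H0].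
rewrite muleA -EFinM -normrM mulrN mulVf// normrN1 mul1e.
apply: eq_integral => v _; rewrite /H1/=; congr (H (_, _)); first by ring.
have -> : (b * u + a * v = (b ^+ 2 * u + a * b * v) / b)%R by field.
have -> : (b ^+ 2 = 1 - a ^+ 2)%R by rewrite -ab; ring.
by field.
Qed.

End lebesgue_rotation.

Section gaussian_rotation.
Local Open Scope ereal_scope.
Context {R : realType} (sigma : R).
Hypothesis sigma0 : sigma != 0%R.
Notation mu := (@lebesgue_measure R).
Notation phi := (normal_pdf 0 sigma).
Notation gam := (gaussian sigma).

Lemma ge0_integral_gaussian (f : R -> \bar R) :
  measurable_fun [set: R] f -> (forall x, 0 <= f x) ->
  \int[gam]_x f x = \int[mu]_x (f x * (phi x)%:E).
Proof.
move=> mf f0; rewrite -ge0_integral_normal_prob//.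
rewrite ge0_integral_pushforward//.
Qed.

Lemma normal_pdf_rotation (a b x y : R) : (a ^+ 2 + b ^+ 2 = 1 ->
  phi (a * x - b * y) * phi (b * x + a * y) = phi x * phi y)%R.
Proof.
move=> ab; rewrite normal_pdfE// /normal_fun !subr0.
rewrite !mulrA [X in (X * _)%R]mulrAC -[LHS]mulrA -expRD.
rewrite [X in (_ = X * _)%R]mulrAC -[RHS]mulrA -expRD; congr (_ * expR _)%R.
rewrite -!mulrDl; congr (_ / _)%R.
transitivity (- ((a ^+ 2 + b ^+ 2) * (x ^+ 2 + y ^+ 2)))%R; first by ring.
by rewrite ab; ring.
Qed.

(** The product of two Gaussian densities only depends on the distance to the origin.
    With [0 <= a] the degenerate case [b = 0] is the identity. *)
Lemma gaussian_rotation (a b : R) (G : R * R -> \bar R) :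
  measurable_fun [set: R * R] G -> (forall z, 0 <= G z) ->
  (a ^+ 2 + b ^+ 2 = 1)%R -> (0 <= a)%R ->
  \int[gam]_x \int[gam]_y G (x, y) =
  \int[gam]_x \int[gam]_y G (a * x - b * y, b * x + a * y)%R.
Proof.
move=> mG G0 ab a0.
have [b0|b0] := eqVneq b 0%R.
  have a1 : a = 1%R.
    by apply/eqP; rewrite -(@eqrXn2 _ 2)// expr1n -ab b0 expr0n addr0.
  apply: eq_integral => x _; apply: eq_integral => y _.
  by rewrite a1 b0 !mul1r !mul0r subr0 add0r.
have dens (F : R * R -> \bar R) : measurable_fun [set: R * R] F ->
    (forall z, 0 <= F z) -> \int[gam]_x \int[gam]_y F (x, y) =
    \int[mu]_x \int[mu]_y (F (x, y) * (phi x * phi y)%:E).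
  move=> mF F0; rewrite ge0_integral_gaussian; last 2 first.
  - exact: (measurable_fun_fubini_tonelli_F F mF F0).
  - by move=> x; apply: integral_ge0.
  apply: eq_integral => x _.
  have mFx : measurable_fun [set: R] (fun y => F (x, y)) by exact: measurableT_comp.
  rewrite ge0_integral_gaussian// muleC -ge0_integralZl//=.
  - by apply: eq_integral => y _; rewrite EFinM muleCA muleA.
  - apply: emeasurable_funM => //; apply/measurable_EFinP.
    exact: measurable_normal_pdf.
  - by move=> y _; rewrite mule_ge0// lee_fin normal_pdf_ge0.
  - by rewrite lee_fin normal_pdf_ge0.
have mrot : measurable_fun [set: R * R]
    (fun z : R * R => (a * z.1 - b * z.2, b * z.1 + a * z.2))%R.
  apply: measurable_fun_pair; [apply: measurable_funB|apply: measurable_funD];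
    exact: measurable_funM.
have mphi := @measurable_normal_pdf R 0 sigma.
pose Grot z := G (a * z.1 - b * z.2, b * z.1 + a * z.2)%R.
have mGrot : measurable_fun [set: R * R] Grot := measurableT_comp mG mrot.
have Grot0 z : 0 <= Grot z by exact: G0.
pose H z := G z * (phi z.1 * phi z.2)%:E.
have mH : measurable_fun [set: R * R] H.
  apply: emeasurable_funM => //; apply/measurable_EFinP.
  by apply: measurable_funM; exact: (measurableT_comp mphi).
have H0 z : 0 <= H z by rewrite mule_ge0// lee_fin mulr_ge0// normal_pdf_ge0.
transitivity (\int[mu]_x \int[mu]_y H (x, y)); first exact: (dens G mG G0).
transitivity (\int[mu]_x \int[mu]_y H (a * x - b * y, b * x + a * y)%R).
  exact: (lebesgue_rotation mH H0 ab b0).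
transitivity (\int[mu]_x \int[mu]_y (Grot (x, y) * (phi x * phi y)%:E)).
  apply: eq_integral => x _; apply: eq_integral => y _.
  by rewrite /H/= normal_pdf_rotation.
by symmetry; exact: (dens Grot mGrot Grot0).
Qed.

End gaussian_rotation.

(** * Gaussian projections of two vectors *)

Section tuple_integral.
Local Open Scope ereal_scope.
Context {R : realType} d (T : measurableType d) (P : probability T R).

Lemma ge0_integral_iidS n (f : n.+1.-tuple T -> \bar R) :
  measurable_fun setT f -> (forall S, 0 <= f S) ->
  \int[iid_law P n.+1]_S f S =
  \int[P]_z \int[iid_law P n]_S f (tuple_cons (z, S)).
Proof.
move=> mf f0; rewrite /= ge0_integral_pushforward//=.
rewrite preimage_setT (fubini_tonelli1 (f \o @tuple_cons _ T n))//.
  by apply: measurableT_comp => //; exact: measurable_tuple_cons.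
by move=> x /=.
Qed.

Lemma ge0_integral_iid0 (f : 0.-tuple T -> \bar R) :
  measurable_fun setT f -> \int[iid_law P 0]_S f S = f [tuple].
Proof. by move=> mf; rewrite /= integral_dirac// diracT mul1e. Qed.

Lemma integral_prob_cst (c : \bar R) : \int[P]_x c = c.
Proof.
rewrite integral_cst//; rewrite -[RHS]mule1; congr (_ * _).
exact: probability_setT.
Qed.

End tuple_integral.

Section gaussian_joint.
Local Open Scope ereal_scope.
Context {R : realType} (sigma : R).
Hypothesis sigma0 : sigma != 0%R.
Notation gam := (gaussian sigma).

Lemma polar_decomposition (a b : R) : (0 <= a)%R -> exists r c s : R,
  [/\ 0 <= r, 0 <= c, c ^+ 2 + s ^+ 2 = 1, a = r * c & b = r * s]%R.
Proof.
move=> a0; pose r := Num.sqrt (a ^+ 2 + b ^+ 2).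
have ab0 : (0 <= a ^+ 2 + b ^+ 2)%R by rewrite addr_ge0 ?sqr_ge0.
have r2 : (r ^+ 2 = a ^+ 2 + b ^+ 2)%R by rewrite sqr_sqrtr.
have [r0|r0] := eqVneq r 0%R.
  exists 0%R, 1%R, 0%R; split => //; first by rewrite expr1n expr0n addr0.
    have : (a ^+ 2 + b ^+ 2 = 0)%R by rewrite -r2 r0 expr0n.
    by move/eqP; rewrite paddr_eq0 ?sqr_ge0// !sqrf_eq0 mul0r => /andP[/eqP].
  have : (a ^+ 2 + b ^+ 2 = 0)%R by rewrite -r2 r0 expr0n.
  by move/eqP; rewrite paddr_eq0 ?sqr_ge0// !sqrf_eq0 mul0r => /andP[_ /eqP].
exists r, (a / r)%R, (b / r)%R; split.
- exact: sqrtr_ge0.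
- by rewrite divr_ge0// sqrtr_ge0.
- by rewrite !expr_div_n -mulrDl -r2 divff// sqrf_eq0.
- by rewrite mulrC divfK.
- by rewrite mulrC divfK.
Qed.

(** A rotation turns [a * x + b * y] into a multiple of the first coordinate. *)
Lemma gaussian_sum (F : R -> \bar R) (a b r : R) :
  measurable_fun setT F -> (forall x, 0 <= F x) ->
  (r ^+ 2 = a ^+ 2 + b ^+ 2)%R ->
  (0 <= a)%R -> (0 <= r)%R ->
  \int[gam]_x \int[gam]_y F (a * x + b * y)%R = \int[gam]_x F (r * x)%R.
Proof.
move=> mF F0 rab a0 r0.
have [r' [c [s [r'0 c0 cs ac bs]]]] := polar_decomposition b a0.
have rE : r = r'.
  apply/eqP; rewrite -(@eqrXn2 _ 2)// rab// ac bs !exprMn -mulrDr cs mulr1//.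
rewrite -{r' r'0}rE in ac bs *.
pose G (z : R * R) := F (a * z.1 + b * z.2)%R.
have mG : measurable_fun setT G.
  apply: (measurableT_comp mF).
  by apply: measurable_funD; apply: measurable_funM.
rewrite (gaussian_rotation sigma0 mG (fun _ => F0 _) cs c0).
apply: eq_integral => x _; rewrite -[RHS](integral_prob_cst gam).
apply: eq_integral => y _; rewrite /G/=; congr F; rewrite ac bs.
transitivity (r * ((c ^+ 2 + s ^+ 2) * x))%R; first by ring.
by rewrite cs mul1r.
Qed.

Definition lin n (c : 'I_n -> R) (g : n.-tuple R) : R := (\sum_j c j * tnth g j)%R.

Lemma lin_cons n (c : 'I_n.+1 -> R) x (g : n.-tuple R) :
  lin c (tuple_cons (x, g)) = (c ord0 * x + lin (fun j => c (lift ord0 j)) g)%R.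
Proof.
rewrite /lin big_ord_recl tnth0; congr (_ + _)%R.
by apply: eq_bigr => j _; rewrite tnthS.
Qed.

Lemma measurable_lin n (c : 'I_n -> R) : measurable_fun setT (lin c).
Proof.
apply: measurable_sum => j; apply: measurable_funM => //.
exact: measurable_tnth.
Qed.

(** The pair of linear forms [(lin h, lin u)] of a centred Gaussian vector has the law
    of a triangular linear image of a two-dimensional one. *)
Definition joint_law n (h u : 'I_n -> R) (al be ga : R) :=
  forall F : R * R -> \bar R, measurable_fun setT F -> (forall z, 0 <= F z) ->
  \int[iid_law gam n]_g F (lin h g, lin u g) =
  \int[gam]_x \int[gam]_y F (al * x, be * x + ga * y)%R.

(** The triangular matrix is a Cholesky factor of the Gram matrix of [h] and [u]. When a
    coordinate is added, one rotation restores the shape of the first form, and another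
    one merges the two remaining independent terms of the second form. *)
Lemma gaussian_joint n (h u : 'I_n -> R) : exists al be ga : R,
  [/\ 0 <= al, 0 <= ga, al ^+ 2 = \sum_j h j ^+ 2, al * be = \sum_j h j * u j &
      be ^+ 2 + ga ^+ 2 = \sum_j u j ^+ 2]%R /\ joint_law h u al be ga.
Proof.
elim: n h u => [|n IH] h u.
  exists 0%R, 0%R, 0%R; split.
    by split=> //; rewrite big_ord0 ?mulr0 ?expr0n ?addr0.
  move=> F mF F0; rewrite ge0_integral_iid0; last first.
    apply: (measurableT_comp mF); apply: measurable_fun_pair; exact: measurable_lin.
  rewrite /lin !big_ord0.
  under eq_integral do under eq_integral do rewrite !mul0r addr0.
  by rewrite !integral_prob_cst.
pose h' j := h (lift ord0 j); pose u' j := u (lift ord0 j).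
have [al [be [ga [[al0 ga0 alE abE bgE] J]]]] := IH h' u'.
(* The rotation maps (al, h ord0) to (r, 0). *)
have [r [c [s [r0 c0 cs alr hr]]]] := polar_decomposition (h ord0) al0.
pose be' := (be * c + u ord0 * s)%R; pose rho := (u ord0 * c - be * s)%R.
pose ga' := Num.sqrt (ga ^+ 2 + rho ^+ 2).
have ga'E : (ga' ^+ 2 = ga ^+ 2 + rho ^+ 2)%R.
  by rewrite sqr_sqrtr// addr_ge0// sqr_ge0.
exists r, be', ga'; split.
  split => //; first exact: sqrtr_ge0.
  - rewrite big_ord_recl -alE alr hr -[LHS]mulr1 -cs; ring.
  - rewrite big_ord_recl -abE alr hr /be'; ring.
  - rewrite big_ord_recl -bgE ga'E /be' /rho.
    transitivity (ga ^+ 2 + (c ^+ 2 + s ^+ 2) * (be ^+ 2 + u ord0 ^+ 2))%R; first by ring.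
    by rewrite cs; ring.
move=> F mF F0.
have mlin (k : 'I_n.+1 -> R) := measurable_lin k.
rewrite ge0_integral_iidS//; last first.
  by apply: (measurableT_comp mF); exact: measurable_fun_pair.
pose G3 (z : (R * R) * R) :=
  F (h ord0 * z.1.2 + al * z.1.1, u ord0 * z.1.2 + be * z.1.1 + ga * z.2)%R.
have mG3 : measurable_fun setT G3.
  apply: (measurableT_comp mF).
  have m11 : measurable_fun setT (fun z : (R * R) * R => z.1.1).
    exact: (measurableT_comp measurable_fst measurable_fst).
  have m12 : measurable_fun setT (fun z : (R * R) * R => z.1.2).
    exact: (measurableT_comp measurable_snd measurable_fst).
  by apply: measurable_fun_pair; repeat apply: measurable_funD;
    apply: measurable_funM.
pose G2 z := \int[gam]_y G3 (z, y).
have mG2 : measurable_fun setT G2.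
  exact: (measurable_fun_fubini_tonelli_F G3 mG3 (fun _ => F0 _)).
have G20 z : 0 <= G2 z by apply: integral_ge0 => y _; exact: F0.
transitivity (\int[gam]_x0 \int[gam]_x G2 (x, x0)).
  apply: eq_integral => x0 _.
  pose F' (z : R * R) := F (h ord0 * x0 + z.1, u ord0 * x0 + z.2)%R.
  have mF' : measurable_fun setT F'.
    apply: (measurableT_comp mF).
    by apply: measurable_fun_pair; apply: measurable_funD.
  transitivity (\int[iid_law gam n]_g F' (lin h' g, lin u' g)).
    by apply: eq_integral => g _; rewrite !lin_cons.
  rewrite (J F' mF' (fun _ => F0 _)).
  apply: eq_integral => x _; apply: eq_integral => y _.
  by rewrite /F' /G3/= addrA.
rewrite -(fubini_tonelli G2 mG2 G20).
rewrite (gaussian_rotation sigma0 mG2 G20 cs c0).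
apply: eq_integral => x _.
pose F2 (t : R) := F (r * x, be' * x + t)%R.
have mF2 : measurable_fun setT F2.
  apply: (measurableT_comp mF).
  by apply: measurable_fun_pair => //; apply: measurable_funD.
transitivity (\int[gam]_x0 \int[gam]_y F2 (ga * y + rho * x0)%R).
  apply: eq_integral => x0 _; apply: eq_integral => y _.
  rewrite /F2 /G3/=; congr (F (_, _)).
    rewrite alr hr; transitivity (r * ((c ^+ 2 + s ^+ 2) * x))%R; first by ring.
    by rewrite cs mul1r.
  by rewrite /be' /rho; ring.
pose F3 (z : R * R) := F2 (ga * z.1 + rho * z.2)%R.
have mF3 : measurable_fun setT F3.
  apply: (measurableT_comp mF2).
  by apply: measurable_funD; apply: measurable_funM.
rewrite -(fubini_tonelli F3 mF3 (fun _ => F0 _)).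
by rewrite (gaussian_sum mF2 (fun _ => F0 _) ga'E ga0 (sqrtr_ge0 _)).
Qed.

End gaussian_joint.

Section gaussian_rows.
Local Open Scope ereal_scope.
Context {R : realType} (sigma : R).
Hypothesis sigma0 : sigma != 0%R.
Notation gam := (gaussian sigma).

Definition sumsq n (x : n.-tuple R) : R := (\sum_i tnth x i ^+ 2)%R.

Lemma sumsq_ge0 n (x : n.-tuple R) : (0 <= sumsq x)%R.
Proof. by apply: sumr_ge0 => i _; exact: sqr_ge0. Qed.

Lemma sumsq_cons n z (x : n.-tuple R) :
  sumsq (tuple_cons (z, x)) = (z ^+ 2 + sumsq x)%R.
Proof.
rewrite /sumsq big_ord_recl tnth0; congr (_ + _)%R.
by apply: eq_bigr => j _; rewrite tnthS.
Qed.

Lemma measurable_sumsq n : measurable_fun setT (@sumsq n).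
Proof.
apply: measurable_sum => j; apply: measurable_funX; exact: measurable_tnth.
Qed.

Lemma measurable_sqrt_fun : measurable_fun setT (fun x : R => Num.sqrt x).
Proof. exact: (continuous_measurable_fun (@sqrt_continuous R)). Qed.

Section fixed_directions.
Variables (d : nat) (h u : 'I_d -> R) (al be ga : R).
Hypothesis J : joint_law sigma h u al be ga.

Definition row_products k (G : k.-tuple (d.-tuple R)) : R :=
  (\sum_i lin h (tnth G i) * lin u (tnth G i))%R.

Lemma row_products_cons k g (G : k.-tuple (d.-tuple R)) :
  row_products (tuple_cons (g, G)) = (lin h g * lin u g + row_products G)%R.
Proof.
rewrite /row_products big_ord_recl tnth0; congr (_ + _)%R.
by apply: eq_bigr => j _; rewrite tnthS.
Qed.

Lemma measurable_row_products k : measurable_fun setT (@row_products k).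
Proof.
apply: measurable_sum => j; apply: measurable_funM;
  exact: (measurableT_comp (measurable_lin _) (measurable_tnth j)).
Qed.

(** Once the values [x] of the first form are fixed, the products are a Gaussian with
    deviation proportional to the length of [x]. In the induction, the new row
    contributes an independent term which [gaussian_sum] merges with the others. *)
Lemma gaussian_row_products k (F : R -> \bar R) :
  measurable_fun setT F -> (forall x, 0 <= F x) ->
  \int[gaussian_mx_law sigma k d]_G F (row_products G) =
  \int[iid_law gam k]_x \int[gam]_z
    F (al * be * sumsq x + al * ga * (Num.sqrt (sumsq x) * z))%R.
Proof.
rewrite /gaussian_mx_law.
elim: k F => [|k IH] F mF F0.
  rewrite !ge0_integral_iid0; last 2 first.
  - exact: (measurableT_comp mF (@measurable_row_products 0)).
  - pose f (z : 0.-tuple R * R) :=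
      F (al * be * sumsq z.1 + al * ga * (Num.sqrt (sumsq z.1) * z.2))%R.
    have mf : measurable_fun setT f.
      apply: (measurableT_comp mF).
      have mN : measurable_fun setT (fun z : 0.-tuple R * R => sumsq z.1).
        exact: (measurableT_comp (@measurable_sumsq 0) measurable_fst).
      apply: measurable_funD; first exact: measurable_funM.
      apply: measurable_funM => //; apply: measurable_funM => //.
      exact: (measurableT_comp measurable_sqrt_fun mN).
    have mg : measurable_fun setT (fun z => \int[gam]_y f (z, y)).
      exact: (measurable_fun_fubini_tonelli_F f mf (fun _ => F0 _)).
    exact: mg.
  rewrite /row_products /sumsq !big_ord0 sqrtr0 mulr0.
  under eq_integral do rewrite mul0r mulr0 addr0.
  by rewrite integral_prob_cst.
have mrow := @measurable_row_products k.+1.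
rewrite [LHS]ge0_integral_iidS//; last exact: (measurableT_comp mF mrow).
pose Q (z : (((R * R) * k.-tuple R) * R)) :=
  F (z.1.1.1 * z.1.1.2 + (al * be * sumsq z.1.2 + al * ga *
     (Num.sqrt (sumsq z.1.2) * z.2)))%R.
have mQ : measurable_fun setT Q.
  apply: (measurableT_comp mF).
  have m1 : measurable_fun setT (fun z : (((R * R) * k.-tuple R) * R) => z.1.1).
    exact: (measurableT_comp measurable_fst measurable_fst).
  have mN : measurable_fun setT (fun z : (((R * R) * k.-tuple R) * R) => sumsq z.1.2).
    apply: (measurableT_comp (@measurable_sumsq k)).
    exact: (measurableT_comp measurable_snd measurable_fst).
  apply: measurable_funD.
    apply: measurable_funM; first exact: (measurableT_comp measurable_fst m1).
    exact: (measurableT_comp measurable_snd m1).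
  apply: measurable_funD; first exact: measurable_funM.
  apply: measurable_funM => //; apply: measurable_funM => //.
  exact: (measurableT_comp measurable_sqrt_fun mN).
pose Q1 z := \int[gam]_y Q (z, y).
have mQ1 : measurable_fun setT Q1.
  exact: (measurable_fun_fubini_tonelli_F Q mQ (fun _ => F0 _)).
have Q10 z : 0 <= Q1 z by apply: integral_ge0 => y _; exact: F0.
pose Q2 z := \int[iid_law gam k]_y Q1 (z, y).
have mQ2 : measurable_fun setT Q2.
  exact: (measurable_fun_fubini_tonelli_F Q1 mQ1 Q10).
have Q20 z : 0 <= Q2 z by apply: integral_ge0.
transitivity (\int[iid_law gam d]_g Q2 (lin h g, lin u g)).
  apply: eq_integral => g _.
  pose F' t := F (lin h g * lin u g + t)%R.
  have mF' : measurable_fun setT F'.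
    by apply: (measurableT_comp mF); apply: measurable_funD.
  transitivity (\int[iid_law (iid_law gam d) k]_G F' (row_products G)).
    by apply: eq_integral => G _; rewrite row_products_cons.
  by rewrite (IH F' mF' (fun _ => F0 _)).
rewrite (J mQ2 Q20).
pose W (z : ((R * k.+1.-tuple R))) :=
  F (al * be * sumsq z.2 + al * ga * (Num.sqrt (sumsq z.2) * z.1))%R.
have mW : measurable_fun setT W.
  apply: (measurableT_comp mF).
  have mN : measurable_fun setT (fun z : R * k.+1.-tuple R => sumsq z.2).
    exact: (measurableT_comp (@measurable_sumsq k.+1) measurable_snd).
  apply: measurable_funD; first exact: measurable_funM.
  apply: measurable_funM => //; apply: measurable_funM => //.
  exact: (measurableT_comp measurable_sqrt_fun mN).
rewrite [RHS]ge0_integral_iidS//; last 2 first.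
- exact: (measurable_fun_fubini_tonelli_G (m1 := gam) W mW (fun _ => F0 _)).
- by move=> x; apply: integral_ge0 => z _; exact: F0.
apply: eq_integral => x _.
pose V (z : R * k.-tuple R) := Q1 ((al * x, be * x + ga * z.1)%R, z.2).
have mV : measurable_fun setT V.
  apply: (measurableT_comp mQ1); apply: measurable_fun_pair => //.
  apply: measurable_fun_pair => //; apply: measurable_funD => //.
  exact: measurable_funM.
rewrite (fubini_tonelli V mV (fun _ => Q10 _)).
apply: eq_integral => x' _.
set N := sumsq x'; have N0 : (0 <= N)%R := sumsq_ge0 x'.
rewrite sumsq_cons -/N.
pose F3 t := F (al * be * (x ^+ 2 + N) + al * ga * t)%R.
have mF3 : measurable_fun setT F3.
  by apply: (measurableT_comp mF); apply: measurable_funD => //; exact: measurable_funM.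
pose F4 (z : R * R) := F3 (Num.sqrt N * z.1 + x * z.2)%R.
have mF4 : measurable_fun setT F4.
  by apply: (measurableT_comp mF3); apply: measurable_funD; exact: measurable_funM.
transitivity (\int[gam]_y \int[gam]_z F4 (z, y)).
  apply: eq_integral => y _; apply: eq_integral => z _.
  by rewrite /Q /F4 /F3/= -/N; congr F; ring.
rewrite -(fubini_tonelli F4 mF4 (fun _ => F0 _)).
have rE : (Num.sqrt (x ^+ 2 + N) ^+ 2 = Num.sqrt N ^+ 2 + x ^+ 2)%R.
  by rewrite !sqr_sqrtr ?addr_ge0 ?sqr_ge0// addrC.
exact: (gaussian_sum sigma0 mF3 (fun _ => F0 _) rE (sqrtr_ge0 _) (sqrtr_ge0 _)).
Qed.

End fixed_directions.
End gaussian_rows.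

(** * Gaussian moments and tails *)

Section gaussian_estimates.
Local Open Scope ereal_scope.
Context {R : realType} (sigma : R).
Hypothesis sigma_gt0 : (0 < sigma)%R.
Notation mu := (@lebesgue_measure R).
Notation phi := (normal_pdf 0 sigma).
Notation gam := (gaussian sigma).

Let sigma0 : sigma != 0%R. Proof. by rewrite gt_eqF. Qed.

(** The integrand times the density of deviation [sigma] is, up to a factor, the
    density of deviation [sigma / s]. *)
Lemma integral_gaussian_expR (s : R) : (0 < s < 1)%R ->
  \int[gam]_x (expR ((1 - s ^+ 2) / 2 * (x / sigma) ^+ 2))%:E = (s^-1)%:E.
Proof.
move=> /andP[s0 s1]; have ss0 : (sigma / s != 0)%R by rewrite gt_eqF// divr_gt0.
rewrite ge0_integral_gaussian//=; last first.
  apply/measurable_EFinP; apply: measurableT_comp => //.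
  apply: measurable_funM => //; apply: measurable_funX; exact: measurable_funM.
transitivity (\int[mu]_x ((s^-1)%:E * (normal_pdf 0 (sigma / s) x)%:E)).
  apply: eq_integral => x _; rewrite -!EFinM; congr EFin.
  rewrite !normal_pdfE// /normal_fun !subr0 mulrCA -expRD [RHS]mulrA; congr (_ * expR _)%R.
    rewrite /normal_peak -[in LHS]mulr_natr -[in RHS]mulr_natr.
    rewrite (_ : (sigma ^+ 2 * pi * 2 = s ^+ 2 * ((sigma / s) ^+ 2 * pi * 2))%R); last first.
      by field; rewrite gt_eqF.
    by rewrite sqrtrM ?sqr_ge0// sqrtr_sqr gtr0_norm// invfM.
  by field; rewrite !gt_eqF.
rewrite ge0_integralZl//=.
- by rewrite integral_normal_pdf mule1.
- by apply/measurable_EFinP; exact: measurable_normal_pdf.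
- by move=> x _; rewrite lee_fin normal_pdf_ge0.
- by rewrite lee_fin invr_ge0 ltW.
Qed.

(** Since [1 + t <= expR t], the exponential moment above bounds the second moment by
    [2 * sigma ^+ 2 / (s * (1 + s))] for all [s] below 1; letting [s] tend to 1
    gives the bound. A second moment larger than [sigma ^+ 2] is excluded by taking
    for [s] the mean of 1 and [sigma ^+ 2 / q]. *)
Lemma gaussian_second_moment : \int[gam]_x (x ^+ 2)%:E <= (sigma ^+ 2)%:E.
Proof.
have m2 : measurable_fun [set: R] (fun x : R => (x ^+ 2)%:E).
  by apply/measurable_EFinP; exact: measurable_funX.
have bound s : (0 < s < 1)%R ->
    ((1 - s ^+ 2) / (2 * sigma ^+ 2))%:E * \int[gam]_x (x ^+ 2)%:E + 1 <= (s^-1)%:E.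
  move=> s01; rewrite -(integral_gaussian_expR s01).
  have /andP[s0 s1] := s01.
  have t0 : (0 <= (1 - s ^+ 2) / (2 * sigma ^+ 2))%R.
    apply: divr_ge0; last by rewrite mulr_ge0// sqr_ge0.
    by rewrite subr_ge0 expr_le1// ltW.
  rewrite -ge0_integralZl//=; last by move=> x _; rewrite lee_fin sqr_ge0.
  rewrite -(integral_prob_cst gam 1) -ge0_integralD//=.
  - apply: ge0_le_integral => //=.
    + by move=> x _; rewrite adde_ge0// mule_ge0// lee_fin sqr_ge0.
    + apply: emeasurable_funD => //; apply: emeasurable_funM => //.
    + apply/measurable_EFinP; apply: measurableT_comp => //.
      apply: measurable_funM => //; apply: measurable_funX; exact: measurable_funM.
    + move=> x _; rewrite -EFinM -EFinD lee_fin addrC.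
      apply: le_trans (expR_ge1Dx _); rewrite lerD2l le_eqVlt; apply/orP; left.
      by apply/eqP; field; rewrite gt_eqF.
  - by move=> x _; rewrite mule_ge0// lee_fin sqr_ge0.
  - exact: emeasurable_funM.
set m := \int[gam]_x (x ^+ 2)%:E in bound *.
have m0 : 0 <= m by apply: integral_ge0 => x _; rewrite lee_fin sqr_ge0.
have mfin : m \is a fin_num.
  rewrite ge0_fin_numE// ltey; apply/eqP => moo.
  have h01 : (0 < (2^-1 : R) < 1)%R by lra.
  have := bound _ h01; rewrite moo gt0_muley ?lte_fin; last first.
    by rewrite divr_gt0 ?mulr_gt0 ?exprn_gt0//; lra.
  by rewrite addye.
rewrite -(fineK mfin) in bound m0 *; set q := fine m in bound m0 *.
rewrite lee_fin; rewrite lee_fin in m0; rewrite leNgt; apply/negP => sq.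
have S0 : (0 < sigma ^+ 2)%R by rewrite exprn_gt0.
have q0 : (0 < q)%R by rewrite (lt_trans S0).
(* By the inequality of means, s ^+ 2 > sigma ^+ 2 / q. *)
pose s := ((1 + sigma ^+ 2 / q) / 2)%R.
have c0 : (0 < sigma ^+ 2 / q)%R by rewrite divr_gt0.
have c1 : (sigma ^+ 2 / q < 1)%R by rewrite ltr_pdivrMr// mul1r.
have s01 : (0 < s < 1)%R by rewrite /s; lra.
have := bound s s01; rewrite -EFinM -EFinD lee_fin.
have /andP[s0 s1] := s01.
have -> : ((1 - s ^+ 2) / (2 * sigma ^+ 2) * q = (1 - s ^+ 2) / 2 / (sigma ^+ 2 / q))%R.
  by field; rewrite !gt_eqF.
set c := (sigma ^+ 2 / q)%R in c0 c1 s s01 s0 s1 *.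
rewrite -lerBrDr ler_pdivrMr// => H.
have H2 : ((1 - s ^+ 2) / 2 * s <= (1 - s) * c)%R.
  rewrite (le_trans (ler_wpM2r (ltW s0) H))// le_eqVlt; apply/orP; left.
  by apply/eqP; field; rewrite gt_eqF.
have : ((1 - s) * ((1 + s) / 2 * s - c) <= 0)%R by move: H2; lra.
rewrite pmulr_rle0; last by lra.
have : (0 < (1 - c) ^+ 2)%R by rewrite exprn_gt0//; lra.
by rewrite /s; nra.
Qed.

Lemma gaussian_opp (f : R -> \bar R) : measurable_fun [set: R] f ->
  (forall x, 0 <= f x) -> \int[gam]_x f x = \int[gam]_x f (- x)%R.
Proof.
move=> mf f0; rewrite !ge0_integral_gaussian//; last exact: measurableT_comp.
have N1 : (-1 != 0 :> R)%R by rewrite oppr_eq0 oner_eq0.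
rewrite (ge0_integral_affine 0%R N1)/=.
- rewrite normrN1 mul1e; apply: eq_integral => x _.
  by rewrite mulN1r addr0 !normal_pdfE// /normal_fun !subr0 sqrrN.
- apply: emeasurable_funM => //; apply/measurable_EFinP.
  exact: measurable_normal_pdf.
- by move=> x; rewrite mule_ge0// lee_fin normal_pdf_ge0.
Qed.

(** By symmetry the two tails have the same mass, and the central interval of
    length [2 * t] has mass at most [2 * t] times the peak of the density. *)
Lemma gaussian_tail (t : R) : (0 <= t)%R ->
  (2^-1)%:E <= \int[gam]_x (\1_(`]-oo, (- t)%R]%classic : set R) x)%:E +
               (normal_peak sigma * t)%:E.
Proof.
move=> t0.
set A : set R := `]-oo, (- t)%R]%classic.
pose B : set R := `[t, +oo[%classic; pose C : set R := `[(- t)%R, t]%classic.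
have mA : measurable A by exact: measurable_itv.
have mB : measurable B by exact: measurable_itv.
have mC : measurable C by exact: measurable_itv.
have mind (D : set R) : measurable D ->
    measurable_fun [set: R] (fun x => (\1_D x : R)%:E).
  by move=> mD; apply/measurable_EFinP; exact: measurable_indic.
have ind0 (D : set R) x : 0 <= (\1_D x : R)%:E by rewrite lee_fin indicE.
have AB : \int[gam]_x (\1_A x)%:E = \int[gam]_x (\1_B x)%:E.
  rewrite gaussian_opp//; last exact: mind.
  apply: eq_integral => x _; congr (_%:E); rewrite !indicE; congr (nat_of_bool _)%:R.
  by apply/idP/idP; rewrite !inE /A /B/= !in_itv/= ?andbT lerN2.
have CE : \int[gam]_x (\1_C x)%:E <= (2 * (normal_peak sigma * t))%:E.
  rewrite ge0_integral_gaussian//; last exact: mind.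
  apply: (@le_trans _ _ (\int[mu]_x ((normal_peak sigma)%:E * (\1_C x)%:E))).
    apply: ge0_le_integral => //=.
    - by move=> x _; rewrite mule_ge0// lee_fin normal_pdf_ge0.
    - apply: emeasurable_funM; first exact: mind.
      by apply/measurable_EFinP; exact: measurable_normal_pdf.
    - by apply: emeasurable_funM => //; exact: mind.
    - move=> x _; rewrite muleC; apply: lee_wpmul2r => //.
      by rewrite lee_fin normal_pdf_ub.
  rewrite ge0_integralZl//=; [|exact: mind|by rewrite lee_fin normal_peak_ge0].
  rewrite integral_indic// setIT.
  rewrite [X in _ * X](_ : _ = lebesgue_measure `[(- t)%R, t]%classic)//.
  rewrite lebesgue_measure_itv/= lte_fin.
  case: ifPn => _; last by rewrite mule0 lee_fin mulr_ge0// mulr_ge0// normal_peak_ge0.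
  by rewrite -EFinB -EFinM lee_fin le_eqVlt; apply/orP; left; apply/eqP; ring.
have one : 1 <= \int[gam]_x (\1_A x)%:E + \int[gam]_x (\1_B x)%:E + \int[gam]_x (\1_C x)%:E.
  have mAB : measurable_fun [set: R] (fun x => (\1_A x : R)%:E + (\1_B x : R)%:E).
    by apply: emeasurable_funD; exact: mind.
  have mABC : measurable_fun [set: R]
      (fun x => (\1_A x : R)%:E + (\1_B x : R)%:E + (\1_C x : R)%:E).
    by apply: emeasurable_funD => //; exact: mind.
  rewrite -(ge0_integralD _ measurableT (fun x _ => ind0 A x) (mind _ mA)
    (fun x _ => ind0 B x) (mind _ mB)).
  rewrite -(ge0_integralD _ measurableT (fun x _ => adde_ge0 (ind0 A x) (ind0 B x)) mAB
    (fun x _ => ind0 C x) (mind _ mC)).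
  rewrite -(integral_prob_cst gam 1).
  apply: ge0_le_integral => //=.
  move=> x _; rewrite -!EFinD lee_fin !indicE.
    have : x \in A \/ x \in B \/ x \in C.
      rewrite !inE /A /B /C/= !in_itv/= andbT.
      case: (lerP x (- t)) => [_|xt]; first by left.
      by case: (lerP t x) => [_|tx]; right; [left|right; rewrite !ltW].
    by move=> [->|[->|->]]/=; do ?case: (_ \in _) => /=; lra.
have Afin : \int[gam]_x (\1_A x)%:E \is a fin_num.
  rewrite integral_indic// setIT; exact: fin_num_measure.
move: one CE; rewrite -AB -(fineK Afin).
have Cfin : \int[gam]_x (\1_C x)%:E \is a fin_num.
  rewrite integral_indic// setIT; exact: fin_num_measure.
rewrite -(fineK Cfin) -!EFinD !lee_fin; lra.
Qed.

Lemma integral_sumsq n : \int[iid_law gam n]_x (sumsq x)%:E <= (n%:R * sigma ^+ 2)%:E.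
Proof.
have mS k : measurable_fun setT (fun x : k.-tuple R => (sumsq x)%:E).
  by apply/measurable_EFinP; exact: measurable_sumsq.
have S0 k (x : k.-tuple R) : 0 <= (sumsq x)%:E by rewrite lee_fin sumsq_ge0.
elim: n => [|n IH].
  by rewrite ge0_integral_iid0// /sumsq big_ord0 mul0r.
rewrite ge0_integral_iidS//.
have m2 : measurable_fun [set: R] (fun x : R => (x ^+ 2)%:E).
  by apply/measurable_EFinP; exact: measurable_funX.
set m := \int[iid_law gam n]_x (sumsq x)%:E in IH.
have m0 : 0 <= m by apply: integral_ge0 => x _; exact: S0.
have inner z : \int[iid_law gam n]_S (sumsq (tuple_cons (z, S)))%:E = (z ^+ 2)%:E + m.
  under eq_integral do rewrite sumsq_cons EFinD.
  rewrite ge0_integralD//=; first by rewrite integral_prob_cst.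
    by move=> x _; rewrite lee_fin sqr_ge0.
  exact: mS.
under eq_integral do rewrite inner.
rewrite ge0_integralD//=; last by move=> x _; rewrite lee_fin sqr_ge0.
rewrite integral_prob_cst -natr1 mulrDl mul1r addrC EFinD.
by apply: leeD => //; exact: gaussian_second_moment.
Qed.

End gaussian_estimates.

(** * A lower bound on the flipping probability *)

Section flip.
Local Open Scope ereal_scope.
Context {R : realType} (sigma : R).
Hypothesis sigma_gt0 : (0 < sigma)%R.
Notation gam := (gaussian sigma).

Let sigma0 : sigma != 0%R. Proof. by rewrite gt_eqF. Qed.

(** Young's inequality [t <= t ^+ 2 / (2 * c) + c / 2] reduces the mean length to the
    mean square length, with [c] the expected order of magnitude. *)
Lemma gaussian_mean_norm k : (0 < k)%N ->
  \int[iid_law gam k]_x (Num.sqrt (sumsq x))%:E <= (sigma * Num.sqrt k%:R)%:E.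
Proof.
move=> k0; set c := (sigma * Num.sqrt k%:R)%R.
have c0 : (0 < c)%R by rewrite mulr_gt0// sqrtr_gt0 ltr0n.
have mS := @measurable_sumsq R k.
have mN : measurable_fun setT (fun x : k.-tuple R => (Num.sqrt (sumsq x))%:E).
  apply/measurable_EFinP; exact: (measurableT_comp (@measurable_sqrt_fun R) mS).
have mSE : measurable_fun setT (fun x : k.-tuple R => (sumsq x)%:E).
  exact/measurable_EFinP.
apply: (@le_trans _ _ (\int[iid_law gam k]_x
    (((2 * c)^-1)%:E * (sumsq x)%:E + (c / 2)%:E))).
  apply: ge0_le_integral => //=.
  - by apply: emeasurable_funD => //; exact: emeasurable_funM.
  move=> x _; rewrite -EFinM -EFinD lee_fin.
  set t := Num.sqrt (sumsq x).
  have -> : sumsq x = (t ^+ 2)%R by rewrite sqr_sqrtr// sumsq_ge0.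
  have -> : ((2 * c)^-1 * t ^+ 2 + c / 2 = t + (t - c) ^+ 2 / (2 * c))%R.
    by field; rewrite gt_eqF.
  by rewrite lerDl divr_ge0 ?sqr_ge0// mulr_ge0// ltW.
rewrite ge0_integralD//=; last 3 first.
- by move=> x _; rewrite -EFinM lee_fin mulr_ge0 ?sumsq_ge0// invr_ge0 mulr_ge0// ltW.
- exact: emeasurable_funM.
- by move=> x _; rewrite lee_fin divr_ge0// ltW.
rewrite integral_prob_cst ge0_integralZl//=; last 2 first.
- by move=> x _; rewrite lee_fin sumsq_ge0.
- by rewrite lee_fin invr_ge0 mulr_ge0// ltW.
apply: (@le_trans _ _ (((2 * c)^-1)%:E * (c ^+ 2)%:E + (c / 2)%:E)).
  apply: leeD => //; apply: lee_wpmul2l.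
    by rewrite lee_fin invr_ge0 mulr_ge0// ltW.
  apply: le_trans (integral_sumsq sigma_gt0 k) _.
  by rewrite lee_fin /c exprMn sqr_sqrtr ?ler0n// mulrC.
rewrite -EFinM -EFinD lee_fin le_eqVlt; apply/orP; left; apply/eqP.
by field; rewrite gt_eqF.
Qed.

(** Conditionally on the projection [x] of [h], the sign flips as soon as a Gaussian
    variable is below [- b * |x|], which has probability at least one half minus the
    peak of the density times [b * |x|]. The mean of [|x|] is at most
    [sigma * sqrt k]. The hypothesis says that [b] is at least the cotangent of the angle
    between [h] and [u], and is stated so that it makes sense for zero vectors. *)
Lemma flip_prob_ge k n (h u : 'cV[R]_n) (b : R) : (0 < k)%N -> (0 <= b)%R ->
  (dotv h u <= b * Num.sqrt (dotv h h * dotv u u - dotv h u ^+ 2))%R ->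
  (1 - b * Num.sqrt (2 * k%:R / pi) <= 2 * flip_prob sigma k u h)%R.
Proof.
move=> k0 b0 hub.
pose hf j := h j 0%R; pose uf j := u j 0%R.
have [al [be [ga [[al0 ga0 alE abE bgE] J]]]] := gaussian_joint sigma0 hf uf.
have hh : dotv h h = (al ^+ 2)%R by rewrite alE dotvE; apply: eq_bigr.
have hu : dotv h u = (al * be)%R by rewrite abE dotvE; apply: eq_bigr.
have uu : dotv u u = (be ^+ 2 + ga ^+ 2)%R by rewrite bgE dotvE; apply: eq_bigr.
have {}hub : (al * be <= b * (al * ga))%R.
  move: hub; rewrite hh hu uu.
  rewrite [X in Num.sqrt X](_ : _ = ((al * ga) ^+ 2)%R); last by ring.
  by rewrite sqrtr_sqr ger0_norm// mulr_ge0.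
pose F (t : R) : \bar R := (\1_(`]-oo, 0%R]%classic : set R) t)%:E.
have mF : measurable_fun [set: R] F.
  by apply/measurable_EFinP; apply: measurable_indic; exact: measurable_itv.
have F0 t : 0 <= F t by rewrite lee_fin indicE.
set A := [set G : k.-tuple (n.-tuple R) |
    (dotv (mx_of_rows G *m h) (mx_of_rows G *m u) <= 0)%R].
have AE : A = @row_products R n hf uf k @^-1` `]-oo, 0%R]%classic.
  apply/seteqP; rewrite /A; suff E (G : k.-tuple (n.-tuple R)) :
      dotv (mx_of_rows G *m h) (mx_of_rows G *m u) = row_products hf uf G.
    by split => G /=; rewrite E in_itv.
  rewrite dotvE; apply: eq_bigr => i _; rewrite !mxE.
  by congr (_ * _)%R; apply: eq_bigr => j _; rewrite mxE mulrC.
have mA : measurable A.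
  rewrite AE -[X in measurable X]setTI; apply: measurable_row_products => //.
have PA : gaussian_mx_law sigma k n A =
    \int[gaussian_mx_law sigma k n]_G F (row_products hf uf G).
  rewrite -[A]setIT -integral_indic//; apply: eq_integral => G _.
  by rewrite /F AE !indicE; congr ((nat_of_bool _)%:R)%:E; apply/idP/idP; rewrite !inE.
rewrite (gaussian_row_products sigma0 J k mF F0) in PA.
pose t (x : k.-tuple R) := (b * Num.sqrt (sumsq x))%R.
have t0 x : (0 <= t x)%R by rewrite mulr_ge0// sqrtr_ge0.
pose I (x : k.-tuple R) := \int[gam]_z F (al * be * sumsq x + al * ga * (Num.sqrt (sumsq x) * z))%R.
pose pk := normal_peak sigma; have pk0 : (0 <= pk)%R by exact: normal_peak_ge0.
have inner x : (2^-1)%:E <= I x + (pk * t x)%:E.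
  apply: le_trans (gaussian_tail sigma_gt0 (t0 x)) _; apply: leeD => //.
  apply: ge0_le_integral => //=.
  - by apply/measurable_EFinP; apply: measurable_indic; exact: measurable_itv.
  - apply: (measurableT_comp mF); apply: measurable_funD => //.
    by apply: measurable_funM => //; exact: measurable_funM.
  move=> z _; rewrite /F lee_fin !indicE.
  case: (boolP (z \in _)) => [|_]; last by rewrite ler0n.
  rewrite inE/= in_itv/= => zt; rewrite mem_set//= in_itv/=.
  set N := sumsq x; set r := Num.sqrt N in zt *.
  have r0 : (0 <= r)%R by exact: sqrtr_ge0.
  have -> : N = (r ^+ 2)%R by rewrite sqr_sqrtr// sumsq_ge0.
  rewrite /t -/N -/r in zt.
  have ag0 : (0 <= al * ga * r)%R by rewrite !mulr_ge0.
  have := ler_wpM2l ag0 zt; have := ler_wpM2r (sqr_ge0 r) hub; nra.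
have mN : measurable_fun setT (fun x : k.-tuple R => (Num.sqrt (sumsq x))%:E).
  apply/measurable_EFinP.
  exact: (measurableT_comp (@measurable_sqrt_fun R) (@measurable_sumsq R k)).
have mI : measurable_fun setT I.
  pose W (z : k.-tuple R * R) :=
    F (al * be * sumsq z.1 + al * ga * (Num.sqrt (sumsq z.1) * z.2))%R.
  have mW : measurable_fun setT W.
    apply: (measurableT_comp mF).
    have mS : measurable_fun setT (fun z : k.-tuple R * R => sumsq z.1).
      exact: (measurableT_comp (@measurable_sumsq R k) measurable_fst).
    apply: measurable_funD; first exact: measurable_funM.
    apply: measurable_funM => //; apply: measurable_funM => //.
    exact: (measurableT_comp (@measurable_sqrt_fun R) mS).
  exact: (measurable_fun_fubini_tonelli_F W mW (fun _ => F0 _)).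
have I0 x : 0 <= I x by exact: integral_ge0.
have pkt x : (pk * t x)%:E = (pk * b)%:E * (Num.sqrt (sumsq x))%:E.
  by rewrite -EFinM /t mulrA.
have main : (2^-1)%:E <= gaussian_mx_law sigma k n A +
    (pk * b * (sigma * Num.sqrt k%:R))%:E.
  rewrite PA; apply: (@le_trans _ _ (\int[iid_law gam k]_x (I x + (pk * t x)%:E))).
    rewrite -(integral_prob_cst (iid_law gam k) (2^-1)%:E).
    apply: ge0_le_integral => //=.
    apply: emeasurable_funD => //; under eq_fun do rewrite pkt.
    exact: emeasurable_funM.
  rewrite ge0_integralD//=; last 2 first.
  - by move=> x _; rewrite lee_fin mulr_ge0.
  - by under eq_fun do rewrite pkt; exact: emeasurable_funM.
  apply: leeD => //; under eq_integral do rewrite pkt.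
  rewrite ge0_integralZl//=; last by rewrite lee_fin mulr_ge0.
  rewrite [leRHS]EFinM; apply: lee_wpmul2l; first by rewrite lee_fin mulr_ge0.
  exact: gaussian_mean_norm.
have Afin : gaussian_mx_law sigma k n A \is a fin_num by exact: fin_num_measure.
move: main; rewrite -(fineK Afin) -EFinD lee_fin => main.
have pkE : (pk * sigma * Num.sqrt k%:R = 2^-1 * Num.sqrt (2 * k%:R / pi))%R.
  have pi0 := pi_gt0 R.
  have pk2 : (pk ^+ 2 = (sigma ^+ 2 * pi *+ 2)^-1)%R.
    rewrite /pk /normal_peak exprVn sqr_sqrtr//.
    by rewrite mulrn_wge0// mulr_ge0 ?sqr_ge0// ltW.
  have k2 : (0 <= 2 * k%:R / pi :> R)%R.
    by rewrite divr_ge0 ?mulr_ge0 ?ler0n ?ltW.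
  apply/eqP; rewrite -(@eqrXn2 _ 2) ?mulr_ge0 ?sqrtr_ge0//; last exact: ltW.
  rewrite !exprMn pk2 !sqr_sqrtr ?ler0n//.
  apply/eqP; move: (@pi R) pi0 => p p0.
  by field; rewrite sigma0 gt_eqF.
rewrite /flip_prob -/A.
have : (pk * b * (sigma * Num.sqrt k%:R) = b / 2 * Num.sqrt (2 * k%:R / pi))%R.
  by transitivity (b * (pk * sigma * Num.sqrt k%:R))%R; [ring|rewrite pkE; ring].
by move: main; lra.
Qed.

End flip.

(** * The ramp loss *)

Section ramp.
Context {R : realType}.

(** The slope is chosen so that the line [1 - slope k * c] stays below
    [1 - sqrt (2 * k / pi) * c / sqrt (1 - c ^+ 2)] wherever it is positive: there
    [1 - c ^+ 2] exceeds [1 - (slope k) ^- 2]. *)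
Definition slope (k : nat) : R := Num.sqrt (1 + 2 * k%:R / pi).

(** A clipped linear function of the cosine [c] that separates the zero-one loss from
    [min 1 (2 * f_k)]. Unlike [f_k] it is Lipschitz for every [k], including [k = 1],
    and it is visibly decreasing in [k]. *)
Definition ramp (k : nat) (c : R) : R := Num.max 0 (Num.min 1 (1 - slope k * c)).

Lemma two_k_div_pi_ge0 k : 0 <= 2 * k%:R / pi :> R.
Proof. by rewrite divr_ge0 ?mulr_ge0 ?ler0n ?pi_ge0. Qed.

Lemma slope_gt0 k : 0 < slope k.
Proof. by rewrite sqrtr_gt0 ltr_pwDl// two_k_div_pi_ge0. Qed.

Lemma slope_sqr k : slope k ^+ 2 = 1 + 2 * k%:R / pi.
Proof. by rewrite sqr_sqrtr// addr_ge0// two_k_div_pi_ge0. Qed.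

Lemma ler_slope j k : (j <= k)%N -> slope j <= slope k.
Proof.
move=> jk; rewrite ler_wsqrtr// lerD2l ler_wpM2r ?invr_ge0 ?pi_ge0//.
by rewrite ler_wpM2l// ler_nat.
Qed.

Lemma ramp_ge0 k c : 0 <= ramp k c.
Proof. by rewrite /ramp le_max lexx. Qed.

Lemma ramp_le1 k c : ramp k c <= 1.
Proof. by rewrite /ramp ge_max ler01 ge_min lexx. Qed.

Lemma ramp_le_line k c : 0 <= 1 - slope k * c -> ramp k c <= 1 - slope k * c.
Proof. by move=> H; rewrite /ramp ge_max H ge_min lexx orbT. Qed.

Lemma ramp_eq1 k c : c <= 0 -> ramp k c = 1.
Proof.
move=> c0; rewrite /ramp min_l; first by rewrite max_r.
by rewrite lerDl oppr_ge0 mulr_ge0_le0// ltW// slope_gt0.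
Qed.

Lemma ramp_eq0 k c : 1 <= slope k * c -> ramp k c = 0.
Proof.
by move=> H; rewrite /ramp max_l// ge_min subr_le0 H orbT.
Qed.

Lemma ramp_anti j k c : (j <= k)%N -> ramp k c <= ramp j c.
Proof.
move=> jk; have [c0|c0] := lerP c 0; first by rewrite !ramp_eq1.
rewrite /ramp le_max2// le_min2//.
by rewrite lerD2l lerN2 ler_wpM2r ?ler_slope// ltW.
Qed.

Lemma ramp_lip k c c' : `|ramp k c - ramp k c'| <= slope k * `|c - c'|.
Proof.
have s0 := slope_gt0 k.
have -> : slope k * `|c - c'| = `|slope k * c - slope k * c'|.
  by rewrite -mulrBr normrM (gtr0_norm s0).
rewrite /ramp; set x := slope k * c; set y := slope k * c'.
rewrite !maxEle !minEle.
by do 4?case: ifPn; rewrite -?ltNge; move=> *; rewrite ler_norml;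
  case: (ger0P (x - y)) => ?; apply/andP; split; lra.
Qed.

End ramp.

Section unit_vectors.
Context {R : realType} (d : nat).
Implicit Types u v : 'cV[R]_d.

(** With the convention [0^-1 = 0], a zero vector is its own direction and has cosine 0
    with every vector, hence ramp loss 1. *)
Definition unitv v : 'cV[R]_d := (Num.sqrt (dotv v v))^-1 *: v.

Lemma unitv_le1 v : dotv (unitv v) (unitv v) <= 1.
Proof.
rewrite /unitv dotvZl dotvZr mulrA -invfM -expr2 sqr_sqrtr ?dotv_ge0//.
by have [->|v0] := eqVneq (dotv v v) 0; rewrite ?mulr0// mulVf.
Qed.

Lemma dotv_unitv u v : dotv (unitv u) (unitv v) =
  dotv u v / (Num.sqrt (dotv u u) * Num.sqrt (dotv v v)).
Proof. by rewrite /unitv dotvZl dotvZr invfM; ring. Qed.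

Lemma dotv_unitv_le0 u v : dotv u v <= 0 -> dotv (unitv u) (unitv v) <= 0.
Proof.
by move=> uv; rewrite dotv_unitv mulr_le0_ge0// invr_ge0.
Qed.

(** If the cosine is not positive, [b = 0] is allowed in [flip_prob_ge] and the right-hand
    side is 1. Otherwise [b] is the cotangent of the angle. *)
Lemma ramp_le_flip sigma k u h : 0 < sigma -> (0 < k)%N ->
  ramp k (dotv (unitv h) (unitv u)) <= Num.min 1 (2 * flip_prob sigma k u h).
Proof.
move=> sigma0 k0; rewrite le_min ramp_le1/=; set c := dotv _ _.
have flip0 : 0 <= flip_prob sigma k u h by rewrite fine_ge0// measure_ge0.
have [uh0|uh0] := lerP (dotv h u) 0.
  have := @flip_prob_ge _ _ sigma0 k d h u 0 k0 (lexx _).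
  rewrite !mul0r subr0 => /(_ uh0) H; apply: le_trans H; exact: ramp_le1.
have [sc|sc] := lerP 1 (slope k * c).
  by rewrite ramp_eq0// mulr_ge0.
have hh : 0 < dotv h h.
  rewrite lt_neqAle dotv_ge0 andbT eq_sym; apply/eqP => /dotv_eq0 h0.
  by move: uh0; rewrite h0 dotvC dotv0r ltxx.
have uu : 0 < dotv u u.
  rewrite lt_neqAle dotv_ge0 andbT eq_sym; apply/eqP => /dotv_eq0 h0.
  by move: uh0; rewrite h0 dotv0r ltxx.
set p := Num.sqrt (dotv h h); set q := Num.sqrt (dotv u u).
have p0 : 0 < p by rewrite sqrtr_gt0.
have q0 : 0 < q by rewrite sqrtr_gt0.
have cE : dotv h u = c * (p * q).
  by rewrite /c dotv_unitv -/p -/q divfK// mulf_neq0// gt_eqF.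
have c0 : 0 < c by rewrite /c dotv_unitv divr_gt0// mulr_gt0.
have s0 : 0 < slope k :> R := slope_gt0 k.
have s1 : 1 <= slope k ^+ 2 :> R by rewrite slope_sqr lerDl two_k_div_pi_ge0.
have sc2 : slope k ^+ 2 * c ^+ 2 < 1 :> R.
  by rewrite -exprMn expr_lt1// mulr_ge0// ltW.
have c2 : 0 < 1 - c ^+ 2 by have := sqr_ge0 c; nra.
pose b := c / Num.sqrt (1 - c ^+ 2).
have r0 : 0 < Num.sqrt (1 - c ^+ 2) by rewrite sqrtr_gt0.
have b0 : 0 <= b by rewrite divr_ge0 ?sqrtr_ge0// ltW.
have hyp : dotv h u <= b * Num.sqrt (dotv h h * dotv u u - dotv h u ^+ 2).
  have -> : dotv h h = p ^+ 2 by rewrite sqr_sqrtr// ltW.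
  have -> : dotv u u = q ^+ 2 by rewrite sqr_sqrtr// ltW.
  rewrite cE (_ : _ - _ = (p * q) ^+ 2 * (1 - c ^+ 2)); last by ring.
  rewrite sqrtrM ?sqr_ge0// sqrtr_sqr ger0_norm; last by rewrite mulr_ge0// ltW.
  rewrite /b le_eqVlt; apply/orP; left; apply/eqP; field.
  by rewrite gt_eqF.
have := @flip_prob_ge _ _ sigma0 k d h u b k0 b0 hyp.
apply: le_trans; apply: le_trans (ramp_le_line _) _; first by rewrite subr_ge0 ltW.
rewrite lerD2l lerN2 /b mulrAC ler_pdivrMr//.
rewrite [leRHS](_ : _ = c * (slope k * Num.sqrt (1 - c ^+ 2))); last by ring.
apply: ler_wpM2l; first exact: ltW.
rewrite -(@ler_pXn2r _ 2) ?nnegrE ?mulr_ge0 ?sqrtr_ge0//.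
rewrite exprMn slope_sqr !sqr_sqrtr ?two_k_div_pi_ge0 ?(ltW c2)//.
by move: sc2; rewrite slope_sqr; lra.
Qed.

End unit_vectors.

(** * A finite net of the unit ball *)

Section net.
Context {R : realType} (d : nat).
Implicit Types u v : 'cV[R]_d.

Lemma dotv_coord_le1 v j : dotv v v <= 1 -> `|v j 0| <= 1.
Proof.
rewrite dotvE (bigD1 j)//= => v1; rewrite -(@expr_le1 _ 2)// real_normK ?num_real//.
rewrite expr2 (le_trans _ v1)// lerDl sumr_ge0// => i _.
by rewrite -expr2 sqr_ge0.
Qed.

(** The net consists of the points of a cubic grid that lie in the ball. Rounding
    coordinates towards zero does not increase the norm, so that every vector of the
    ball has a close neighbour in the net. *)
Lemma ball_net (eta : R) : 0 < eta ->
  exists (I : finType) (i0 : I) (w : I -> 'cV[R]_d),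
    (forall i, dotv (w i) (w i) <= 1) /\
    forall v, dotv v v <= 1 -> exists i, forall e, dotv e e <= 1 ->
      `|dotv (w i) e - dotv v e| <= eta.
Proof.
move=> eta0; pose m := (Num.truncn (d%:R / eta)).+1.
have m0 : 0 < m%:R :> R by rewrite ltr0n.
have dm : d%:R / m%:R <= eta.
  by rewrite ler_pdivrMr// mulrC -ler_pdivrMr// ltW// truncnS_gt.
pose I : finType := {ffun 'I_d -> 'I_m.+1 * bool}.
pose grid (f : I) : 'cV[R]_d :=
  \col_j ((-1) ^+ (f j).2 * ((f j).1 : nat)%:R / m%:R).
pose w f := if dotv (grid f) (grid f) <= 1 then grid f else 0.
exists I, [ffun=> (ord0, false)], w; split.
  by move=> f; rewrite /w; case: ifP => // _; rewrite dotv0r.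
move=> v v1; have vj j : `|v j 0| <= 1 by exact: dotv_coord_le1.
pose f : I := [ffun j => (inord (Num.truncn (m%:R * `|v j 0|)), v j 0 < 0)].
pose t j : R := (Num.truncn (m%:R * `|v j 0|))%:R / m%:R.
have gridE j : grid f j 0 = (-1) ^+ (v j 0 < 0)%R * t j.
  rewrite mxE ffunE/= inordK ?mulrA// ltnS truncn_le_nat.
  by rewrite (@le_lt_trans _ _ m%:R) ?ltr_nat// ler_piMr// ltW.
have t_itv j : 0 <= t j <= `|v j 0| /\ `|v j 0| - t j <= m%:R^-1.
  have x0 : 0 <= m%:R * `|v j 0| by rewrite mulr_ge0// ltW.
  have /andP[] := truncn_itv x0.
  have tE : (Num.truncn (m%:R * `|v j 0|))%:R = m%:R * t j.
    by rewrite [RHS]mulrC divfK// gt_eqF.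
  rewrite -natr1 tE ler_pM2l// => tv vt; split.
    by rewrite tv divr_ge0 ?ler0n.
  by rewrite -(ler_pM2l m0) mulrBr mulfV ?gt_eqF//; lra.
have close j : `|grid f j 0 - v j 0| <= m%:R^-1.
  have [/andP[tj0 tj1] tj2] := t_itv j; rewrite gridE.
  move: tj1 tj2; case: (ltrP (v j 0) 0) => vj0.
    by rewrite expr1 mulN1r ltr0_norm// => ? ?; rewrite ler_norml; apply/andP; split; lra.
  by rewrite expr0 mul1r ger0_norm// => ? ?; rewrite ler_norml; apply/andP; split; lra.
have small : dotv (grid f) (grid f) <= 1.
  apply: le_trans v1; rewrite !dotvE; apply: ler_sum => j _.
  have [/andP[tj0 tj1] _] := t_itv j.
  rewrite -!expr2 -[leLHS]real_normK ?num_real// -[leRHS]real_normK ?num_real//.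
  rewrite ler_pXn2r ?nnegrE// gridE normrM normrX normrN1 expr1n mul1r.
  by rewrite (ger0_norm tj0).
exists f => e e1; rewrite /w small !dotvE -sumrB.
apply: le_trans dm; apply: le_trans (ler_norm_sum _ _ _) _.
have -> : d%:R / m%:R = \sum_(j < d) m%:R^-1 :> R.
  by rewrite sumr_const card_ord mulr_natl.
apply: ler_sum => j _; rewrite -mulrBl normrM -[leRHS]mulr1.
by rewrite ler_pM// dotv_coord_le1.
Qed.
End net.

(** * Uniform deviation of the ramp loss *)

Section ramp_deviation.
Context {R : realType} (d : nat).
Variable D : probability (d.-tuple R * bool)%type R.

Definition direction (z : d.-tuple R * bool) : 'cV[R]_d := unitv (signed_point z).

Lemma measurable_coord (j : 'I_d) :
  measurable_fun setT (fun z : d.-tuple R * bool => signed_point z j 0).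
Proof.
under eq_fun do rewrite !mxE.
apply: measurable_funM; last first.
  exact: (measurableT_comp (measurable_tnth j) measurable_fst).
by apply: (measurableT_comp (f := fun b : bool => label b)).
Qed.

Lemma measurable_dotv (v : 'cV[R]_d) :
  measurable_fun setT (fun z : d.-tuple R * bool => dotv v (signed_point z)).
Proof.
under eq_fun do rewrite dotvE.
by apply: measurable_sum => j; apply: measurable_funM => //; exact: measurable_coord.
Qed.

Lemma bmf_dotv_direction (v : 'cV[R]_d) : dotv v v <= 1 ->
  bounded_measurable (fun z => dotv v (direction z)).
Proof.
move=> v1; split; last first.
  exists 1 => z; rewrite -sqrtr_sqr -sqrtr1 ler_wsqrtr//.
  apply: le_trans (cauchy_schwarz _ _) _; rewrite mulr_ile1 ?dotv_ge0//.
  exact: unitv_le1.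
rewrite /direction /unitv; under eq_fun do rewrite dotvZr.
apply: measurable_funM; last exact: measurable_dotv.
have -> : (fun z => (Num.sqrt (dotv (signed_point z) (signed_point z)))^-1) =
    (fun z : d.-tuple R * bool => dotv (signed_point z) (signed_point z) `^ (- 2^-1)).
  by apply/funext => z; rewrite powRN powR12_sqrt// dotv_ge0.
apply: (measurableT_comp (measurable_powR (- 2^-1))).
under eq_fun do rewrite dotvE.
by apply: measurable_sum => j; apply: measurable_funM; exact: measurable_coord.
Qed.

Lemma measurable_ramp k : measurable_fun [set: R] (@ramp R k).
Proof.
apply: measurable_maxr => //.
rewrite [X in measurable_fun _ X](_ : _ = fun c => - Num.max (-1) (slope k * c - 1)).
  apply: measurableT_comp => //; apply: measurable_maxr => //.
  by apply: measurable_funB => //; exact: measurable_funM.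
apply/funext => c; rewrite minEle maxEle.
by do 2?case: ifPn; rewrite -?ltNge; move=> *; lra.
Qed.

Lemma bmf_ramp k (v : 'cV[R]_d) : dotv v v <= 1 ->
  bounded_measurable (fun z => ramp k (dotv v (direction z))).
Proof.
move=> v1; split.
  exact: (measurableT_comp (measurable_ramp k) (bmf_dotv_direction v1).1).
by exists 1 => z; rewrite ger0_norm ?ramp_ge0 ?ramp_le1.
Qed.

(** Misclassified points have a cosine that is not positive, where the ramp is 1. *)
Lemma gen_error_le k (h : 'cV[R]_d) :
  gen_error D h <= \int[D]_z ramp k (dotv (unitv h) (direction z)).
Proof.
set A := [set z : d.-tuple R * bool | dotv h (signed_point z) <= 0].
have mA : measurable A.
  have := measurable_fun_ler (measurable_dotv h) (measurable_cst (0 : R)).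
  by move=> /(_ measurableT [set true]); rewrite setTI; exact.
have bA : bounded_measurable (\1_A : _ -> R).
  split; first exact: measurable_indic.
  by exists 1 => z; rewrite indicE; case: (_ \in _); rewrite ?normr1 ?normr0.
have -> : gen_error D h = \int[D]_z \1_A z.
  by rewrite /gen_error /Rintegral integral_indic// setIT.
have bR := bmf_ramp k (unitv_le1 h).
apply: (bmf_le_Rint D bA bR) => z; rewrite indicE.
case: (boolP (z \in A)) => [|_]; last exact: ramp_ge0.
by rewrite inE => zA; rewrite ramp_eq1// /direction dotv_unitv_le0.
Qed.

(** The tail bound is applied to the ramp losses of a finite net of directions, fine
    enough for the Lipschitz bound to cost at most [eps] overall. *)
Lemma uniform_ramp_bound k N (dl eps : R) : (0 < N)%N -> 0 < dl <= 1 -> 0 < eps ->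
  exists A : set (N.-tuple (d.-tuple R * bool)),
    [/\ measurable A, ((1 - dl)%:E <= iid_law D N A)%E &
    forall S, A S -> forall h : 'cV[R]_d,
      gen_error D h <= N%:R^-1 * (\sum_(z <- S) ramp k (dotv (unitv h) (direction z)))
        + 2 * slope k / Num.sqrt N%:R + Num.sqrt (2 * ln dl^-1 / N%:R) + eps].
Proof.
move=> N0 /andP[dl0 dl1] eps0.
set L : R := slope k; have L0 : 0 < L := slope_gt0 k.
have N0' : 0 < N%:R :> R by rewrite ltr0n.
have [I [i0 [w [w1 wnet]]]] := ball_net d (divr_gt0 eps0 (mulr_gt0 (ltr0n R 2) L0)).
pose g i z := ramp k (dotv (w i) (direction z)).
have bg i : bounded_measurable (g i) := bmf_ramp k (w1 i).
have be i := bmf_dotv_direction (w1 i).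
have e1 z : dotv (direction z) (direction z) <= 1 by exact: unitv_le1.
have gL i j z : `|g i z - g j z| <=
    L * `|dotv (w i) (direction z) - dotv (w j) (direction z)| by exact: ramp_lip.
have g1 i x y : `|g i x - g i y| <= 1.
  have := ramp_ge0 k (dotv (w i) (direction x)); have := ramp_le1 k (dotv (w i) (direction x)).
  have := ramp_ge0 k (dotv (w i) (direction y)); have := ramp_le1 k (dotv (w i) (direction y)).
  by rewrite -/(g i x) -/(g i y) ler_norml; lra.
pose s := Num.sqrt (2 * N%:R * ln dl^-1).
have lndl : 0 <= ln dl^-1 by rewrite ln_ge0// invf_ge1.
have s2 : s ^+ 2 = 2 * N%:R * ln dl^-1 by rewrite sqr_sqrtr// !mulr_ge0.
pose psi i z := \int[D]_y g i y - g i z.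
have bpsi i : bounded_measurable (psi i) := bmfB (bmf_cst _ _) (bg i).
pose F := @sample_max R _ _ _ i0 psi (fun=> 0) N.
pose tau := 2 * L * Num.sqrt N%:R + s.
pose B := [set S | tau < F S].
have mF : measurable_fun setT F.
  have bF : bounded_measurable F by exact: bmf_sample_max1.
  exact: bF.1.
have mB : measurable B.
  have := measurable_fun_ltr (measurable_cst tau) mF.
  by move=> /(_ measurableT [set true]); rewrite setTI; exact.
have PB : (iid_law D N B <= dl%:E)%E.
  have := @sample_max_tail _ _ _ D _ i0 _ g w direction L bg be (ltW L0) w1 e1 gL
    N s N0 (sqrtr_ge0 _) g1.
  rewrite s2 (_ : 2 * N%:R * ln dl^-1 / (2 * N%:R) = ln dl^-1); last first.
    by field; rewrite gt_eqF.
  by rewrite lnV ?posrE// opprK lnK ?posrE.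
exists (~` B); split; first exact: measurableC.
  rewrite probability_setC// EFinB; apply: leeB => //.
move=> S /negP; rewrite -leNgt => FS h.
have [i wi] := wnet (unitv h) (unitv_le1 h).
have half : L * (eps / (2 * L)) = eps / 2 by field; rewrite gt_eqF.
have gr z : `|g i z - ramp k (dotv (unitv h) (direction z))| <= eps / 2.
  apply: le_trans (ramp_lip _ _ _) _; rewrite -half.
  by apply: ler_wpM2l; [exact: ltW|exact: wi].
have bh := bmf_ramp k (unitv_le1 h).
have gen : gen_error D h <= \int[D]_z g i z + eps / 2.
  apply: le_trans (gen_error_le k h) _; rewrite -bmf_RintDc//.
  apply: (bmf_le_Rint D bh (bmfD (bg i) (bmf_cst _ _))) => z.
  by have := gr z; rewrite ler_norml => /andP[]; lra.
have emp : \sum_(z <- S) g i z <=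
    \sum_(z <- S) ramp k (dotv (unitv h) (direction z)) + N%:R * (eps / 2).
  have -> : N%:R * (eps / 2) = \sum_(z <- S) (eps / 2).
    by rewrite big_tuple sumr_const card_ord mulr_natl.
  rewrite -big_split/=; apply: ler_sum => z _.
  by have := gr z; rewrite ler_norml => /andP[]; lra.
have dev : N%:R * \int[D]_z g i z - \sum_(z <- S) g i z <= tau.
  apply: le_trans FS; apply: le_trans (fmax_ge _ _ i).
  rewrite add0r sumrB lerD2r.
  by rewrite big_tuple sumr_const card_ord mulr_natl.
set E := \sum_(z <- S) ramp _ _ in emp *; set G := \int[D]_z g i z in gen dev.
have sN : Num.sqrt N%:R ^+ 2 = N%:R :> R by rewrite sqr_sqrtr.
have rN0 : 0 < Num.sqrt N%:R :> R by rewrite sqrtr_gt0.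
have sE : Num.sqrt (2 * ln dl^-1 / N%:R) = s / N%:R.
  rewrite (_ : 2 * ln dl^-1 / N%:R = (2 * N%:R * ln dl^-1) / N%:R ^+ 2); last first.
    by field; rewrite gt_eqF.
  rewrite sqrtrM; last by rewrite !mulr_ge0.
  by rewrite -exprVn sqrtr_sqr ger0_norm// invr_ge0 ltW.
have NG : N%:R * G <= E + N%:R * (eps / 2) + tau by lra.
have {}NG : G <= N%:R^-1 * (E + N%:R * (eps / 2) + tau).
  by rewrite ler_pdivlMl.
rewrite sE; apply: le_trans gen _.
apply: le_trans (lerD NG (lexx _)) _; rewrite le_eqVlt; apply/orP; left; apply/eqP.
rewrite /tau; move: sN rN0; set r := Num.sqrt N%:R => sN r0; rewrite -sN.
by field; rewrite gt_eqF.
Qed.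

End ramp_deviation.

(** * Numerical constants *)

Section numerics.
Context {R : realType}.

Lemma ler_sqrtD (a b : R) : 0 <= a -> 0 <= b ->
  Num.sqrt (a + b) <= Num.sqrt a + Num.sqrt b.
Proof.
move=> a0 b0; rewrite -(@ler_pXn2r _ 2) ?nnegrE ?addr_ge0 ?sqrtr_ge0//.
rewrite sqrrD !sqr_sqrtr ?addr_ge0// -addrA lerD2l lerDr.
by rewrite mulrn_wge0// mulr_ge0 ?sqrtr_ge0.
Qed.

Lemma two_div_pi_ge : 2^-1 <= 2 / pi :> R.
Proof.
have pi0 := pi_gt0 R; have := pihalf_lt2 R.
by rewrite ler_pdivlMr//; lra.
Qed.

Lemma ln2_ge_half : 2^-1 <= ln 2 :> R.
Proof.
rewrite -ler_expR lnK ?posrE//.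
have e : expR (2^-1) * expR (- 2^-1) = 1 :> R by rewrite -expRD subrr expR0.
have h : 2^-1 <= expR (- 2^-1) :> R by have := expR_ge1Dx (- 2^-1 : R); lra.
have e0 := expR_gt0 (2^-1 : R).
by nra.
Qed.

(** The numerical room left by the constants: the left-hand side is twice the slope
    plus the price of the weights [2 ^- k] in the union bound, and the difference
    pays for the net. *)
Lemma slope_budget (k : nat) : (0 < k)%N ->
  2 * slope k + 2 * Num.sqrt (ln 2 / 2) * Num.sqrt k.-1%:R <
  (2 * Num.sqrt (2 / pi) + 3 * Num.sqrt (ln 2 / 2)) * Num.sqrt k%:R :> R.
Proof.
move=> k0; set p := Num.sqrt (2 / pi); set q := Num.sqrt (ln 2 / 2).
set x := Num.sqrt k%:R; set y := Num.sqrt k.-1%:R; set s := slope k.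
have pi0 := pi_gt0 R.
have tp0 : 0 <= 2 / pi :> R by rewrite divr_ge0// ltW.
have p2 : p ^+ 2 = 2 / pi by rewrite sqr_sqrtr.
have q2 : q ^+ 2 = ln 2 / 2.
  by rewrite sqr_sqrtr// divr_ge0//; apply: le_trans ln2_ge_half; lra.
have x2 : x ^+ 2 = k%:R by rewrite sqr_sqrtr.
have y2 : y ^+ 2 = k%:R - 1 by rewrite sqr_sqrtr// -(prednK k0) -natr1 addrK.
have s2 : s ^+ 2 = 1 + p ^+ 2 * x ^+ 2 by rewrite slope_sqr p2 x2; congr (_ + _); ring.
have p0 : 0 <= p by exact: sqrtr_ge0.
have q0 : 0 <= q by exact: sqrtr_ge0.
have y0 : 0 <= y by exact: sqrtr_ge0.
have s0 : 0 < s by exact: slope_gt0.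
have k1 : 1 <= k%:R :> R by rewrite ler1n.
have x1 : 1 <= x by rewrite -sqrtr1 ler_wsqrtr.
have p7 : 7 / 10 <= p.
  rewrite -(@ler_pXn2r _ 2) ?nnegrE// p2.
  by apply: le_trans two_div_pi_ge; lra.
have q5 : 2^-1 <= q.
  rewrite -(@ler_pXn2r _ 2) ?nnegrE// q2.
  by have := ln2_ge_half; lra.
(* After multiplication by x, the two sides differ by at least 3 * q - 1 / p, where
   3 * q >= 3 / 2 and p >= 7 / 10. *)
have H1 : 2 * (s - p * x) * x * p <= 1.
  by have := sqr_ge0 (s - p * x); move: s2; lra.
have H2 : 3 * q <= (3 * q * x - 2 * q * y) * x.
  have [k1'|k2] := leqP k 1.
    have kE : k = 1%N by apply/eqP; rewrite eqn_leq k1' k0.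
    have -> : y = 0 by rewrite /y kE sqrtr0.
    by rewrite mulr0 subr0; nra.
  have k2' : 2 <= k%:R :> R by rewrite ler_nat.
  have xy : 2 * (x * y) <= 2 * k%:R - 1.
    by have := sqr_ge0 (x - y); rewrite sqrrB x2 y2; lra.
  have -> : (3 * q * x - 2 * q * y) * x = q * (3 * x ^+ 2 - 2 * (x * y)) by ring.
  by rewrite x2 mulrC ler_wpM2l//; lra.
have H3 : 2 * (s - p * x) * x < 3 * q.
  suff : 2 * (s - p * x) * x * p < 3 * q * p by rewrite ltr_pM2r//; lra.
  by apply: le_lt_trans H1 _; nra.
have : 2 * (s - p * x) * x < (3 * q * x - 2 * q * y) * x by lra.
by rewrite ltr_pM2r; lra.
Qed.

End numerics.

(** * The generalization bound *)

Section tail_sum.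
Context {R : realType}.

Lemma sum_half_pow (n : nat) : \sum_(i < n) (2 ^+ i.+1)^-1 = 1 - (2 ^+ n)^-1 :> R.
Proof.
elim: n => [|n IH]; first by rewrite big_ord0 expr0 invr1 subrr.
rewrite big_ord_recr/= IH exprS invfM; set x := (2 ^+ n)^-1.
by field.
Qed.

Lemma measure_finite_meet d (T : measurableType d) (P : probability T R) (n : nat)
    (A : nat -> set T) (dl : nat -> R) :
  (forall i, measurable (A i)) -> (forall i, ((1 - dl i)%:E <= P (A i))%E) ->
  exists B : set T, [/\ measurable B,
    ((1 - \sum_(i < n) dl i)%:E <= P B)%E & forall x, B x -> forall i, (i < n)%N -> A i x].
Proof.
move=> mA PA; pose U := \big[setU/set0]_(i < n) ~` A i.
have mU : measurable U by apply: bigsetU_measurable => i _; exact: measurableC.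
exists (~` U); split; first exact: measurableC.
  rewrite probability_setC// EFinB; apply: leeB => //.
  have : (P U <= \sum_(i < n) P (~` A i))%E.
    by apply: (@Boole_inequality _ _ _ P (fun i => ~` A i) n) => i _; exact: measurableC.
  move=> /le_trans; apply.
  rewrite -sumEFin; apply: lee_sum => i _.
  have := PA i; rewrite probability_setC//.
  by rewrite -(fineK (fin_num_measure P _ (mA i))) -EFinB !lee_fin; lra.
move=> x; rewrite /U -(bigcup_mkord n (fun i => ~` A i)) => nU i iltn; apply: contrapT => nA.
by apply: nU; exists i.
Qed.
End tail_sum.

Theorem theorem3p2 (R : realType) (d N : nat) (N_gt0 : (0 < N)%N)
    (D : probability (d.-tuple R * bool)%type R)
    (sigma : R) (sigma_gt0 : 0 < sigma)
    (k : 'cV[R]_d -> 'cV[R]_d -> nat)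
    (k_gt0 : forall x h, (0 < k x h)%N)
    (delta : R) (delta_gt0 : 0 < delta) :
  exists A : set (N.-tuple (d.-tuple R * bool)),
    [/\ measurable A,
        ((1 - delta)%:E <= iid_law D N A)%E &
        forall S, A S -> forall h : 'cV[R]_d,
          let z (n : 'I_N) := signed_point (tnth S n) in
          let kmax := (\max_(n < N) k (z n) h)%N in
          gen_error D h <=
            N%:R^-1 * (\sum_(n < N)
              Num.min 1 (2 * flip_prob sigma (k (z n) h) (z n) h))
            + 2 * Num.sqrt (2 / pi) * Num.sqrt (N%:R^-1 * kmax%:R)
            + 3 * Num.sqrt (ln (2 / delta) / (2 * N%:R))
            + 3 * Num.sqrt (ln 2 / 2) * Num.sqrt (N%:R^-1 * kmax%:R)].
Proof.
have [delta_ge1|delta_lt1] := lerP 1 delta.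
  by exists set0; split => //; rewrite measure0 lee_fin; lra.
have N0 : 0 < N%:R :> R by rewrite ltr0n.
pose p : R := Num.sqrt (2 / pi); pose q : R := Num.sqrt (ln 2 / 2).
pose rN : R := Num.sqrt N%:R; have rN0 : 0 < rN by rewrite sqrtr_gt0.
(* Index i stands for the projection dimension i.+1, with weight 2 ^- i.+1. *)
pose dl i : R := delta / 2 ^+ i.+1.
have dl01 i : 0 < dl i <= 1.
  rewrite divr_gt0 ?exprn_gt0//= ler_pdivrMr ?exprn_gt0// mul1r.
  by rewrite (le_trans (ltW delta_lt1))// exprn_ege1// ler1n.
(* the slack of slope_budget *)
pose eps i : R := ((2 * p + 3 * q) * Num.sqrt i.+1%:R
  - (2 * slope i.+1 + 2 * q * Num.sqrt i%:R)) / rN.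
have eps0 i : 0 < eps i by rewrite divr_gt0// subr_gt0; exact: (@slope_budget R i.+1).
have /choice[A HA] := fun i => @uniform_ramp_bound R d D i.+1 N _ _ N_gt0 (dl01 i) (eps0 i).
have [||B [mB PB BA]] := @measure_finite_meet _ _ _ (iid_law D N) N A dl.
- by move=> i; have [] := HA i.
- by move=> i; have [] := HA i.
exists B; split => //.
  apply: le_trans PB; rewrite lee_fin lerD2l lerN2 -mulr_sumr sum_half_pow.
  by rewrite ler_piMr ?ltW// gerBl invr_ge0 exprn_ge0.
move=> S BS h.
pose z (n : 'I_N) := signed_point (tnth S n).
pose kmax := (\max_(n < N) k (z n) h)%N.
pose emp := \sum_(n < N) Num.min 1 (2 * flip_prob sigma (k (z n) h) (z n) h).
suff : gen_error D h <= N%:R^-1 * emp + 2 * p * Num.sqrt (N%:R^-1 * kmax%:R)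
    + 3 * Num.sqrt (ln (2 / delta) / (2 * N%:R))
    + 3 * q * Num.sqrt (N%:R^-1 * kmax%:R) by [].
have flip0 n : 0 <= Num.min 1 (2 * flip_prob sigma (k (z n) h) (z n) h).
  by rewrite le_min ler01 mulr_ge0// fine_ge0// measure_ge0.
have emp0 : 0 <= emp by apply: sumr_ge0 => n _; exact: flip0.
have p0 : 0 <= p by exact: sqrtr_ge0.
have q0 : 0 <= q by exact: sqrtr_ge0.
have kn n : (k (z n) h <= kmax)%N by exact: (leq_bigmax_cond (F := fun n => k (z n) h)).
have kmax0 : (0 < kmax)%N by apply: leq_trans (k_gt0 _ _) (kn (Ordinal N_gt0)).
have sq : Num.sqrt (N%:R^-1 * kmax%:R) = Num.sqrt kmax%:R / rN.
  by rewrite mulrC sqrtrM ?ler0n// sqrtrV// ltW.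
have [Nk|kN] := ltnP N kmax.
  (* the complexity term alone exceeds 1 *)
  have g1 : gen_error D h <= 1.
    apply: le_trans (gen_error_le D kmax h) _.
    by apply: bmf_Rint_le => [|x]; [exact: bmf_ramp (unitv_le1 h)|exact: ramp_le1].
  apply: le_trans g1 _.
  have one : 1 <= 2 * p * Num.sqrt (N%:R^-1 * kmax%:R).
    have p2 : p ^+ 2 = 2 / pi by rewrite sqr_sqrtr// divr_ge0// pi_ge0.
    have h2 : 2^-1 <= 2 / pi :> R := two_div_pi_ge.
    have k1 : 1 <= Num.sqrt (N%:R^-1 * kmax%:R) :> R.
      rewrite -[leLHS]sqrtr1 ler_wsqrtr// ler_pdivlMl// mulr1 ler_nat ltnW//.
    have p5 : 2^-1 <= p.
      by rewrite -(@ler_pXn2r _ 2) ?nnegrE// p2; lra.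
    by nra.
  have t1 : 0 <= N%:R^-1 * emp by rewrite mulr_ge0// invr_ge0 ltW.
  have t3 : 0 <= 3 * Num.sqrt (ln (2 / delta) / (2 * N%:R)) :> R.
    by rewrite mulr_ge0// sqrtr_ge0.
  have t4 : 0 <= 3 * q * Num.sqrt (N%:R^-1 * kmax%:R).
    by rewrite !mulr_ge0// sqrtr_ge0.
  by lra.
have iK : kmax.-1.+1 = kmax by rewrite prednK.
have [_ _ HS] := HA kmax.-1.
have kmaxN : (kmax.-1 < N)%N by rewrite iK.
apply: le_trans (HS S (BA S BS _ kmaxN) h) _; rewrite iK.
have ramp_emp : \sum_(x <- S) ramp kmax (dotv (unitv h) (direction x)) <= emp.
  rewrite big_tuple; apply: ler_sum => n _.
  apply: le_trans (ramp_anti _ (kn n)) _.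
  exact: ramp_le_flip.
set E := \sum_(x <- S) _ in ramp_emp *.
have {ramp_emp} NE : N%:R^-1 * E <= N%:R^-1 * emp.
  by rewrite ler_wpM2l// invr_ge0 ltW.
pose X := ln (2 / delta) / (2 * N%:R); pose Y : R := ln 2 / 2 * kmax.-1%:R / N%:R.
have ln20 : 0 <= ln 2 :> R by apply: le_trans ln2_ge_half.
have X0 : 0 <= X.
  apply: divr_ge0; last by rewrite mulr_ge0// ltW.
  by rewrite ln_ge0// ler_pdivlMr// mul1r; lra.
have Y0 : 0 <= Y by rewrite !(mulr_ge0, divr_ge0) ?ler0n.
have lnE : 2 * ln (dl kmax.-1)^-1 / N%:R = 2 ^+ 2 * (X + Y).
  have -> : (dl kmax.-1)^-1 = 2 ^+ kmax.-1 * (2 / delta).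
    by rewrite /dl exprS; field; rewrite gt_eqF// expf_neq0.
  rewrite lnM ?posrE ?exprn_gt0 ?divr_gt0// lnXn// -[_ *+ kmax.-1]mulr_natr /X /Y.
  by field; rewrite gt_eqF.
have YE : Num.sqrt Y = q * Num.sqrt kmax.-1%:R / rN.
  rewrite /Y sqrtrM; last by rewrite mulr_ge0 ?ler0n// divr_ge0.
  by rewrite sqrtrM ?divr_ge0// sqrtrV// ltW.
have XY := ler_sqrtD X0 Y0.
rewrite lnE sqrtrM ?sqr_ge0// sqrtr_sqr ger0_norm//.
rewrite -/X sq /eps iK; rewrite YE in XY.
have sX : 0 <= Num.sqrt X by exact: sqrtr_ge0.
move: (Num.sqrt (X + Y)) (Num.sqrt X) XY sX => xy x XY sX.
rewrite -/rN; move: (rN^-1) XY => r XY.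
by lra.
Qed.
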